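(* If a family $\mathcal{F}$ of four non-overlapping unit balls in $\mathbb{R}^3$ minimally pins a line $\ell$ (that is, $\mathcal{F}$ pins $\ell$ and no proper subset of $\mathcal{F}$ pins $\ell$), then $(\mathcal{F}, \ell)$ is an alternating hyperboloidal configuration.
   Context: A unit ball is a closed ball of radius one. A family of balls is non-overlapping if its members have pairwise disjoint interiors (they may touch). A line transversal to a non-overlapping family is a line that intersects every member of the family and that is not tangent to two touching members at their common point of contact (equivalently, common points of contact are removed from the sets, which makes them pairwise disjoint). A family $\mathcal{F}$ pins a line $\ell$ if $\ell$ is a line transversal to $\mathcal{F}$ and no sufficiently small perturbation of $\ell$ other than $\ell$ itself is a line transversal to $\mathcal{F}$; equivalently, $\ell$ is an isolated point of the space of line transversals to $\mathcal{F}$, with the natural topology on the space of lines. If $X$ is a ball tangent to a line $\ell$, the ridge $r_\ell(X)$ of $X$ with respect to $\ell$ is the line that passes through the point $X\cap \ell$, is tangent to $X$ there, and is perpendicular to $\ell$. Four or more lines are in hyperboloidal configuration if they are all contained in the same family of rulings of a hyperbolic paraboloid or of a hyperboloid of one sheet. An alternating hyperboloidal configuration is a pair $(\mathcal{F},\ell)$ where $\mathcal{F}$ is a family of four unit balls and $\ell$ is a line tangent to every member of $\mathcal{F}$ such that: (i) the ridges $\{r_\ell(X) \mid X\in\mathcal{F}\}$ are in hyperboloidal configuration, witnessed by a hyperbolic paraboloid $\mathcal{H}$ (i.e. they belong to one family of rulings of $\mathcal{H}$); and (ii) the normals to $\mathcal{H}$ at its tangency points with the balls of $\mathcal{F}$,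 each directed towards the center of the corresponding ball and taken in order along $\ell$, point to alternating sides of $\mathcal{H}$. Here the sides of $\mathcal{H}$ are the two connected components of $\mathbb{R}^3\setminus\mathcal{H}$; condition (i) forces $\ell\subset\mathcal{H}$, and each ball $X\in\mathcal{F}$ is tangent to $\mathcal{H}$ at the point $X\cap\ell$ (the tangent planes of $X$ and $\mathcal{H}$ there coincide), which is the tangency point referred to in (ii). *)

(* Defs.v *)
From HB Require Import structures.
From mathcomp Require Import all_boot all_order all_algebra.
From mathcomp Require Import all_classical all_reals all_analysis.
Set Implicit Arguments.
Unset Strict Implicit.
Unset Printing Implicit Defensive.
Import Order.TTheory GRing.Theory Num.Theory.
Import numFieldNormedType.Exports.
Local Open Scope classical_set_scope.
Local Open Scope ring_scope.
Local Open Scope card_scope.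

(* The library norm on ['rV[R]_3] is the sup norm: it induces the usual
   topology, but metric notions below are stated with [enorm]. *)
Definition dot {R : realType} (u v : 'rV[R]_3) : R := \sum_i u 0 i * v 0 i.

Definition enorm {R : realType} (u : 'rV[R]_3) : R := Num.sqrt (dot u u).

Definition eball {R : realType} (c : 'rV[R]_3) (r : R) : set 'rV[R]_3 :=
  [set x | enorm (x - c) <= r].

Definition unit_ball {R : realType} (X : set 'rV[R]_3) : Prop :=
  exists c, X = eball c 1.

Definition affine_line {R : realType} (z : 'rV[R]_3 * 'rV[R]_3) :
  set 'rV[R]_3 := [set z.1 + t *: z.2 | t in [set: R]].

Record line (R : realType) := Line {
  line_set :> set 'rV[R]_3;
  _ : exists2 z, z.2 != 0 & line_set = affine_line z }.

Lemma line_set_inj (R : realType) : injective (@line_set R).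
Proof.
move=> [A hA] [B hB] /= AB; rewrite -{B}AB in hB *.
by rewrite (Prop_irrelevance hA hB).
Qed.

HB.instance Definition _ (R : realType) := gen_eqMixin (line R).
HB.instance Definition _ (R : realType) := gen_choiceMixin (line R).

(* The space of lines carries the quotient topology for the map
   (p, v) |-> p + R v defined on pairs with v nonzero. *)
Definition line_params {R : realType} (U : set (line R)) :
    set ('rV[R]_3 * 'rV[R]_3) :=
  [set z | z.2 != 0 /\ exists2 l, U l & l = affine_line z :> set _].

Definition line_open {R : realType} (U : set (line R)) : Prop :=
  open (line_params U).

Section LineTopology.
Variable R : realType.

Lemma line_openT : line_open [set: line R].
Proof.
rewrite /line_open (_ : line_params _ = snd @^-1` [set v | v != 0]); last first.
  apply/seteqP; split=> [z []//|z /= z0]; split=> //.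
  have zl : exists2 z', z'.2 != 0 & affine_line z = affine_line z' by exists z.
  by exists (Line zl).
apply: open_comp; first by move=> ? _; exact: cvg_snd.
rewrite (_ : [set _ | _] = ~` [set 0]).
  by apply: closed_openC; apply: accessible_closed_set1; apply: hausdorff_accessible;
    exact: norm_hausdorff.
by apply/seteqP; split=> v /= /eqP.
Qed.

Lemma line_openI (A B : set (line R)) :
  line_open A -> line_open B -> line_open (A `&` B).
Proof.
move=> oA oB; rewrite /line_open.
rewrite (_ : line_params _ = line_params A `&` line_params B); first exact: openI.
apply/seteqP; split=> z /= => [[z0 [l [Al Bl] lz]]|].
  by split; split=> //; exists l.
move=> [[z0 [l Al lz]] [_ [m Bm mz]]]; split=> //; exists l => //; split=> //.
by rewrite (_ : l = m) //; apply: line_set_inj; rewrite lz mz.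
Qed.

Lemma line_open_bigU (I : Type) (f : I -> set (line R)) :
  (forall i, line_open (f i)) -> line_open (\bigcup_i f i).
Proof.
move=> of_; rewrite /line_open.
rewrite (_ : line_params _ = \bigcup_i line_params (f i)).
  by apply: bigcup_open => i _; exact: of_.
apply/seteqP; split=> z /= => [[z0 [l [i _ il] lz]]|[i _ [z0 [l il lz]]]].
  by exists i => //; split=> //; exists l.
by split=> //; exists l => //; exists i.
Qed.

End LineTopology.

HB.instance Definition _ (R : realType) :=
  isOpenTopological.Build (line R) (@line_openT R) (@line_openI R)
    (@line_open_bigU R).

Definition perpendicular {R : realType} (l m : line R) : Prop :=
  forall x y u v, line_set l x -> line_set l y -> line_set m u -> line_set m v ->
    dot (y - x) (v - u) = 0.

(* Only used for closed balls [X] of positive radius, for which a line is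
   tangent to [X] at [p] iff it meets [X] exactly in [p]. *)
Definition tangent_at {R : realType} (l : line R) (X : set 'rV[R]_3)
  (p : 'rV[R]_3) : Prop := l `&` X = [set p].

Definition four_unit_balls {R : realType} (F : set (set 'rV[R]_3)) : Prop :=
  F #= [set: 'I_4] /\ F `<=` unit_ball.

Definition non_overlapping {R : realType} (F : set (set 'rV[R]_3)) : Prop :=
  trivIset F interior.

Definition line_transversal {R : realType} (F : set (set 'rV[R]_3))
    (l : line R) : Prop :=
  (forall X, F X -> l `&` X !=set0) /\
  (forall X Y p, F X -> F Y -> X <> Y -> ~ (tangent_at l X p /\ tangent_at l Y p)).

Definition pins {R : realType} (F : set (set 'rV[R]_3)) (l : line R) : Prop :=
  isolated [set m | line_transversal F m] l.

Definition minimally_pins {R : realType} (F : set (set 'rV[R]_3)) (l : line R) :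
  Prop := pins F l /\ forall G, G `<` F -> ~ pins G l.

Definition is_ridge {R : realType} (l : line R) (X : set 'rV[R]_3)
    (r : line R) : Prop :=
  exists p, [/\ tangent_at l X p, tangent_at r X p & perpendicular r l].

Definition ridges {R : realType} (F : set (set 'rV[R]_3)) (l : line R) :
  set (line R) := [set r | exists2 X, F X & is_ridge l X r].

Definition hyperbolic_paraboloid {R : realType} (H : set 'rV[R]_3) : Prop :=
  exists (Q : 'M[R]_3) (o : 'rV[R]_3) (a b : R),
    [/\ Q *m Q^T = 1%:M, 0 < a, 0 < b &
     H = [set y *m Q + o | y in
           [set y : 'rV[R]_3 | y 0 2 = (y 0 0 / a) ^+ 2 - (y 0 1 / b) ^+ 2]]].

(* On a hyperbolic paraboloid, lines of different rulings always meet, so the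
   partitions of the surface into lines are exactly its two rulings. *)
Definition ruling_family {R : realType} (H : set 'rV[R]_3) (G : set (line R)) :
  Prop := H = \bigcup_(l in G) l /\ trivIset G (@line_set R).

Definition hyperboloidal_on {R : realType} (H : set 'rV[R]_3)
    (Ls : set (line R)) : Prop :=
  [set: 'I_4] #<= Ls /\ exists2 G, ruling_family H G & Ls `<=` G.

Definition side {R : realType} (H S : set 'rV[R]_3) : Prop :=
  exists2 x, ~ H x & S = connected_component (~` H) x.

(* [n] is orthogonal to the tangent plane: <n, x - p> = o(|x - p|) as x -> p
   along [H]. *)
Definition normal_at {R : realType} (H : set 'rV[R]_3) (p n : 'rV[R]_3) : Prop :=
  [/\ H p, n != 0 &
    forall e : R, 0 < e ->
      \forall x \near p, H x -> `|dot n (x - p)| <= e * enorm (x - p)].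

Definition points_to_side {R : realType} (p n : 'rV[R]_3) (S : set 'rV[R]_3) :
  Prop := \forall t \near (0 : R)^'+, S (p + t *: n).

Definition directed_to_center {R : realType} (X : set 'rV[R]_3)
    (p n : 'rV[R]_3) : Prop :=
  exists c (k : R), [/\ X = eball c 1, 0 < k & c - p = k *: n].

(* [X] enumerates [F] in the order of the tangency points [p i] along [l],
   for the orientation of [l] given by [v]; [odd i] makes sides alternate. *)
Definition alternating_normals {R : realType} (F : set (set 'rV[R]_3))
    (l : line R) (H : set 'rV[R]_3) : Prop :=
  exists (X : 'I_4 -> set 'rV[R]_3) (p n : 'I_4 -> 'rV[R]_3) (v : 'rV[R]_3)
         (S : bool -> set 'rV[R]_3),
    [/\ F = range X, forall i, tangent_at l (X i) (p i), v != 0 &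
        forall i j : 'I_4, (i < j)%N -> exists2 s : R, 0 < s & p j = p i + s *: v] /\
    [/\ side H (S true), side H (S false), S true <> S false &
        forall i, [/\ normal_at H (p i) (n i), directed_to_center (X i) (p i) (n i) &
                      points_to_side (p i) (n i) (S (odd i))]].

Definition alternating_hyperboloidal {R : realType} (F : set (set 'rV[R]_3))
    (l : line R) : Prop :=
  [/\ four_unit_balls F,
      forall X, F X -> exists p, tangent_at l X p &
      exists H, [/\ hyperbolic_paraboloid H, hyperboloidal_on H (ridges F l) &
                    alternating_normals F l H]].

(* Main.v *)
(* Write the line as p + R d with |d| = 1 and the centres as p + z_i d + m_i with m_i
   orthogonal to d; ball i is tangent iff |m_i| = 1.  The clause on contact points makes
   the heights z_i of the tangent balls distinct.  If some (q, w) satisfies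
   m_i.(q + z_i w) > 0 for every tangent ball, then moving the line along (q, w) yields
   nearby transversals, so pinning and Gordan's alternative give weights lam_i >= 0, not
   all zero, with sum lam_i m_i = sum lam_i z_i m_i = 0.  With D_i = prod_(j != i)
   (z_i - z_j), interpolation gives D_i lam_i m_i = A + z_i B for two vectors A, B.  If A
   and B are parallel, the m_i of positive weight are all parallel, and three balls of
   them lie on alternating sides in a plane through the line; such a triple already pins
   the line, against minimality.  Otherwise all lam_i are positive and
   (A + ((x - p).d) B).(x - p) = 0 is the required hyperbolic paraboloid: its horizontal
   ruling at height z_i is the ridge of ball i, and the sides alternate because the sign
   of D_i does. *)
Require Import Defs.
From mathcomp Require Import all_boot all_order all_algebra.
From mathcomp Require Import all_classical all_reals all_analysis.
From mathcomp Require Import ring lra.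
Set Implicit Arguments.
Unset Strict Implicit.
Unset Printing Implicit Defensive.
Import Order.TTheory GRing.Theory Num.Theory.
Import numFieldNormedType.Exports.
Local Open Scope classical_set_scope.
Local Open Scope ring_scope.

(** * Vectors in dimension three *)

Section DotProduct.
Variable R : realType.
Implicit Types (u v w x y : 'rV[R]_3) (a : R).

Lemma row3P u v :
  u 0 0 = v 0 0 -> u 0 1 = v 0 1 -> u 0 2 = v 0 2 -> u = v.
Proof.
move=> h0 h1 h2; apply/rowP => -[[|[|[|//]]] i3].
- by rewrite (_ : Ordinal i3 = 0) //; apply: val_inj.
- by rewrite (_ : Ordinal i3 = 1) //; apply: val_inj.
- by rewrite (_ : Ordinal i3 = 2) //; apply: val_inj.
Qed.

Lemma dot3E u v : dot u v = u 0 0 * v 0 0 + u 0 1 * v 0 1 + u 0 2 * v 0 2.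
Proof.
rewrite /dot !big_ord_recl big_ord0 addr0 addrA.
by congr (_ + u 0 _ * v 0 _ + u 0 _ * v 0 _); apply: val_inj.
Qed.

Lemma dotC u v : dot u v = dot v u.
Proof. by rewrite !dot3E; ring. Qed.
Lemma dotDl u v w : dot (u + v) w = dot u w + dot v w.
Proof. by rewrite !dot3E !mxE; ring. Qed.
Lemma dotDr u v w : dot w (u + v) = dot w u + dot w v.
Proof. by rewrite !dot3E !mxE; ring. Qed.
Lemma dotNl u v : dot (- u) v = - dot u v.
Proof. by rewrite !dot3E !mxE; ring. Qed.
Lemma dotNr u v : dot u (- v) = - dot u v.
Proof. by rewrite !dot3E !mxE; ring. Qed.
Lemma dotZl a u v : dot (a *: u) v = a * dot u v.
Proof. by rewrite !dot3E !mxE; ring. Qed.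
Lemma dotZr a u v : dot u (a *: v) = a * dot u v.
Proof. by rewrite !dot3E !mxE; ring. Qed.
Lemma dot0l u : dot 0 u = 0.
Proof. by rewrite !dot3E !mxE; ring. Qed.
Lemma dot0r u : dot u 0 = 0.
Proof. by rewrite dotC dot0l. Qed.
Definition dotE := (dotDl, dotDr, dotNl, dotNr, dotZl, dotZr, dot0l, dot0r).

Lemma dot_ge0 u : 0 <= dot u u.
Proof. by rewrite dot3E !addr_ge0 // -expr2 sqr_ge0. Qed.

Lemma dot_eq0 u : (dot u u == 0) = (u == 0).
Proof.
apply/eqP/eqP => [|->]; last exact: dot0l.
rewrite dot3E => h; have [h0 h1 h2] : [/\ u 0 0 = 0, u 0 1 = 0 & u 0 2 = 0].
  by split; nra.
by apply: row3P; rewrite !mxE.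
Qed.

Lemma dot_gt0 u : (0 < dot u u) = (u != 0).
Proof. by rewrite lt0r dot_eq0 dot_ge0 andbT. Qed.

(** Lagrange's identity: the gap is a sum of three squares. *)
Lemma dot_CS u v : dot u v ^+ 2 <= dot u u * dot v v.
Proof.
rewrite -subr_ge0 !dot3E.
rewrite (_ : _ - _ = (u 0 0 * v 0 1 - u 0 1 * v 0 0) ^+ 2
  + (u 0 0 * v 0 2 - u 0 2 * v 0 0) ^+ 2
  + (u 0 1 * v 0 2 - u 0 2 * v 0 1) ^+ 2); last by ring.
by rewrite !addr_ge0 // sqr_ge0.
Qed.

Lemma enorm_ge0 u : 0 <= enorm u. Proof. exact: sqrtr_ge0. Qed.

Lemma enorm_sqr u : enorm u ^+ 2 = dot u u.
Proof. by rewrite sqr_sqrtr // dot_ge0. Qed.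

Lemma enorm_le1 u : (enorm u <= 1) = (dot u u <= 1).
Proof. by rewrite -enorm_sqr -[1 in RHS](expr1n R 2) ler_sqr ?nnegrE ?enorm_ge0. Qed.

Lemma normr_dot_le u v : `|dot u v| <= enorm u * enorm v.
Proof.
by rewrite -sqrtr_sqr -sqrtrM ?dot_ge0// ler_sqrt ?dot_CS// mulr_ge0 ?dot_ge0.
Qed.

Definition cross u v : 'rV[R]_3 := \row_(j < 3)
  if j == 0 then u 0 1 * v 0 2 - u 0 2 * v 0 1
  else if j == 1 then u 0 2 * v 0 0 - u 0 0 * v 0 2
  else u 0 0 * v 0 1 - u 0 1 * v 0 0.

Lemma cross0E u v : cross u v 0 0 = u 0 1 * v 0 2 - u 0 2 * v 0 1.
Proof. by rewrite mxE. Qed.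
Lemma cross1E u v : cross u v 0 1 = u 0 2 * v 0 0 - u 0 0 * v 0 2.
Proof. by rewrite mxE. Qed.
Lemma cross2E u v : cross u v 0 2 = u 0 0 * v 0 1 - u 0 1 * v 0 0.
Proof. by rewrite mxE. Qed.
Definition crossE := (cross0E, cross1E, cross2E).

Lemma dot_crossl u v : dot (cross u v) u = 0.
Proof. by rewrite dot3E !crossE; ring. Qed.
Lemma dot_crossr u v : dot (cross u v) v = 0.
Proof. by rewrite dot3E !crossE; ring. Qed.

Lemma dot_cross u v :
  dot (cross u v) (cross u v) = dot u u * dot v v - dot u v ^+ 2.
Proof. by rewrite !dot3E !crossE; ring. Qed.

(** The double product [cross x (cross u v)] vanishes, and with [c = cross u v] the two sides differ
    by [cross c (cross x c)]. So [x] is parallel to [c] as soon as [c] is nonzero. *)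
Lemma perp_cross u v x : dot x u = 0 -> dot x v = 0 ->
  dot (cross u v) (cross u v) *: x = dot x (cross u v) *: cross u v.
Proof.
move=> hu hv.
have c0 : cross x (cross u v) = 0.
  have -> : cross x (cross u v) = dot x v *: u - dot x u *: v.
    by apply: row3P; rewrite !dot3E /cross !mxE /=; ring.
  by rewrite hu hv !scale0r subr0.
apply/eqP; rewrite -subr_eq0; apply/eqP.
have -> : dot (cross u v) (cross u v) *: x - dot x (cross u v) *: cross u v =
    cross (cross u v) (cross x (cross u v)).
  move: (cross u v) => c.
  by apply: row3P; rewrite !dot3E /cross !mxE /=; ring.
by rewrite c0; apply: row3P; rewrite /cross !mxE /=; ring.
Qed.

Lemma ex_perp u : exists2 v, v != 0 & dot u v = 0.
Proof.
have [->|u0] := eqVneq u 0.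
  exists (delta_mx 0 0); last exact: dot0l.
  by apply/eqP => /rowP/(_ 0)/eqP; rewrite !mxE/= oner_eq0.
suff [e] : exists e, cross u e != 0.
  by exists (cross u e) => //; rewrite dotC dot_crossl.
(* If every [cross u e] vanished, two basis vectors would already kill all coordinates of [u]. *)
apply: contra_notP (negP u0) => /forallNP h; apply/eqP.
have c e : cross u e = 0 by have /negP := h e; rewrite negbK => /eqP.
have h1 := c (delta_mx 0 1); have h0 := c (delta_mx 0 0).
have /rowP/(_ 0) := h1; have /rowP/(_ 2) := h1; have /rowP/(_ 2) := h0.
rewrite !crossE !mxE /= => e2 e0 e1.
by apply: row3P; rewrite mxE; lra.
Qed.

End DotProduct.

(** * Gordan's theorem of the alternative *)

Section Gordan.
Variables (R : realFieldType) (d : nat).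
Implicit Types x y b : 'rV[R]_d.

Let scal x y : R := (x *m y^T) 0 0.

Let scalDl x y z : scal (x + y) z = scal x z + scal y z.
Proof. by rewrite /scal mulmxDl mxE. Qed.
Let scalZl k x y : scal (k *: x) y = k * scal x y.
Proof. by rewrite /scal -scalemxAl mxE. Qed.
Let scalC x y : scal x y = scal y x.
Proof. by rewrite /scal -[in RHS](trmxK y) -trmx_mul [in RHS]mxE. Qed.
Let scalDr x y z : scal z (x + y) = scal z x + scal z y.
Proof. by rewrite scalC scalDl !(scalC z). Qed.
Let scalZr k x y : scal y (k *: x) = k * scal y x.
Proof. by rewrite scalC scalZl scalC. Qed.
Let scal_gt0 x : x != 0 -> 0 < scal x x.
Proof.
move=> x0; rewrite /scal mxE lt0r sumr_ge0 ?andbT; last first.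
  by move=> i _; rewrite mxE -expr2 sqr_ge0.
apply: contraNneq x0 => /eqP; rewrite psumr_eq0; last first.
  by move=> i _; rewrite mxE -expr2 sqr_ge0.
move=> /allP h; apply/eqP/rowP => i; rewrite mxE.
by have := h i (mem_index_enum _); rewrite mxE mulf_eq0 orbb => /eqP.
Qed.

(** A small step along [b] turns the weak inequality at [b] into a strict one, and finitely many
    strict inequalities survive it. *)
Let gordan_push (I : eqType) (s : seq I) (a : I -> 'rV[R]_d) b y :
  {in s, forall i, 0 < scal (a i) y} -> 0 <= scal b y -> b != 0 ->
  exists2 e, 0 < scal b (y + e *: b)
           & {in s, forall i, 0 < scal (a i) (y + e *: b)}.
Proof.
move=> ay yb b0.
suff [e e0 he] : exists2 e : R, 0 < e &
    {in s, forall i, 0 < scal (a i) (y + e *: b)}.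
  exists e => //; rewrite scalDr scalZr; have := scal_gt0 b0; nra.
elim: s ay => [|i s IH] ay; first by exists 1.
have [|e e0 he] := IH; first by move=> j js; apply: ay; rewrite inE js orbT.
have ai := ay i (mem_head _ _).
(* The step [f] keeps the value at [i] positive; the summand 1 covers the case where [a i] is
   orthogonal to [b]. *)
pose f := scal (a i) y / (1 + `|scal (a i) b|).
have n0 : 0 < 1 + `|scal (a i) b| by rewrite ltr_pwDl.
have f0 : 0 < f by rewrite divr_gt0.
have m0 : 0 < Num.min e f by rewrite lt_min e0 f0.
exists (Num.min e f) => // j; rewrite inE => /orP[/eqP ->|js].
  rewrite scalDr scalZr.
  have mf : Num.min e f * (1 + `|scal (a i) b|) <= scal (a i) y.
    by rewrite -ler_pdivlMr // ge_min lexx orbT.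
  have := ler_norm (- scal (a i) b); rewrite normrN; nra.
(* The value is affine in the step and positive at both 0 and [e], hence also in between. *)
have := he j js; rewrite !scalDr !scalZr.
have aj : 0 < scal (a j) y by apply: ay; rewrite inE js orbT.
have : Num.min e f <= e by rewrite ge_min lexx.
nra.
Qed.

(** Induction on the list. If the solution [x] for the tail is negative on the new vector [b], the
    tail is projected along [b] onto the hyperplane orthogonal to [x], and the induction hypothesis
    is used again on the projections. *)
Lemma gordan (I : eqType) (s : seq I) (a : I -> 'rV[R]_d) : uniq s ->
  (exists x, {in s, forall i, 0 < (a i *m x^T) 0 0}) \/
  (exists lam : I -> R, [/\ forall i, 0 <= lam i,
     exists2 i, i \in s & 0 < lam i & \sum_(i <- s) lam i *: a i = 0]).
Proof.
elim: s a => [|k s IH] a /=; first by left; exists 0.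
move=> /andP[ks us]; set b := a k.
have sE (f g : I -> R) : \sum_(i <- s) (if i == k then f i else g i) *: a i =
    \sum_(i <- s) g i *: a i.
  apply: eq_big_seq => i iS; case: eqP => // ik.
  by rewrite -ik iS in ks.
have [b0|b0] := eqVneq b 0.
  right; exists (fun i => if i == k then 1 else 0); split.
  - by move=> i; case: ifP.
  - by exists k; rewrite ?mem_head// eqxx.
  - by rewrite big_cons eqxx -/b b0 scaler0 add0r sE big1 // => i; rewrite scale0r.
have push y : {in s, forall i, 0 < scal (a i) y} -> 0 <= scal b y ->
    exists x, {in k :: s, forall i, 0 < scal (a i) x}.
  move=> ay yb; have [e e1 e2] := gordan_push ay yb b0.
  by exists (y + e *: b) => i; rewrite inE => /orP[/eqP->|/e2].
have [[x ax]|[lam [l0 [j js lj] lE]]] := IH a us; last first.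
  right; exists (fun i => if i == k then 0 else lam i); split.
  - by move=> i; case: ifP.
  - exists j; first by rewrite inE js orbT.
    by case: eqP => // jk; rewrite -jk js in ks.
  - by rewrite big_cons eqxx scale0r add0r sE.
have [bx|bx] := leP 0 (scal b x); first by left; exact: push ax bx.
(* A positive combination of [a i] and [b], up to the weight of [b], chosen orthogonal to [x]. *)
pose a' i := (- scal b x) *: a i + scal (a i) x *: b.
have [[y ay]|[lam [l0 [j js lj] lE]]] := IH a' us; last first.
  (* Unfolding [a'] in its dependency collects this total weight on [b]. *)
  right; exists (fun i => if i == k then \sum_(i <- s) lam i * scal (a i) x
                          else - scal b x * lam i); split.
  - move=> i; case: ifP => _; last by rewrite mulr_ge0 // oppr_ge0 ltW.
    rewrite big_seq sumr_ge0 // => h hs; by rewrite mulr_ge0 // ltW // ax.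
  - exists j; first by rewrite inE js orbT.
    case: eqP => [jk|_]; first by rewrite -jk js in ks.
    by rewrite mulr_gt0 // oppr_gt0.
  - rewrite big_cons eqxx sE scaler_suml -big_split -[RHS]lE /=.
    by apply: eq_bigr => i _; rewrite /a' -/b scalerDr !scalerA addrC mulrC.
(* Moving [y] along [x] into the hyperplane orthogonal to [b] leaves its products with the [a' i]
   unchanged, and there they are positive multiples of the products with [a i]. *)
pose y' := y + (- (scal b y / scal b x)) *: x.
have by' : scal b y' = 0 by rewrite /y' scalDr scalZr; field; rewrite lt_eqF.
left; apply: (push y'); last by rewrite by'.
move=> i iS; have : 0 < scal (a' i) y := ay i iS; rewrite /a' scalDl !scalZl /y' scalDr scalZr.
move: (scal (a i) y) (scal b y) (scal (a i) x) => ai_y b_y ai_x h.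
have bxn : 0 < - scal b x by rewrite oppr_gt0.
rewrite -(pmulr_rgt0 _ bxn).
by rewrite (_ : _ * _ = - scal b x * ai_y + ai_x * b_y) //; field; rewrite lt_eqF.
Qed.

End Gordan.

(** * Lines and tangency *)

Section Lines.
Variable R : realType.
Implicit Types (p v c d x q w : 'rV[R]_3) (l m : line R).

Lemma eball1E c x : eball c 1 x <-> dot (x - c) (x - c) <= 1.
Proof. by rewrite /eball /= enorm_le1; split. Qed.

Lemma dot_subC x c : dot (x - c) (x - c) = dot (c - x) (c - x).
Proof. by rewrite -opprB dotNl dotNr opprK. Qed.

Lemma mem_affine_line p v (t : R) : affine_line (p, v) (p + t *: v).
Proof. by exists t. Qed.

Lemma affine_line_reparam p v (t k : R) : k != 0 ->
  affine_line (p + t *: v, k *: v) = affine_line (p, v).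
Proof.
move=> k0; apply/seteqP; split=> [_ [s _ <-]|_ [s _ <-]] /=.
  by exists (t + s * k) => //=; rewrite scalerDl addrA scalerA.
exists ((s - t) / k) => //=; rewrite scalerA -addrA -scalerDl.
by congr (_ + _ *: _); field.
Qed.

Lemma affine_line_eq p v p' v' : affine_line (p, v) = affine_line (p', v') ->
  exists t k : R, p = p' + t *: v' /\ v = k *: v'.
Proof.
move=> e.
have [t _ /= tE] : affine_line (p', v') p by rewrite -e; exists 0; rewrite //= scale0r addr0.
have [s _ /= sE] : affine_line (p', v') (p + v) by rewrite -e; exists 1; rewrite //= scale1r.
exists t, (s - t); split => //.
apply: (addrI p); rewrite -sE -tE -addrA -scalerDl.
by congr (_ + _ *: _); ring.
Qed.

Lemma mk_line p v : v != 0 -> exists l, line_set l = affine_line (p, v).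
Proof.
move=> v0.
have h : exists2 z, z.2 != 0 & affine_line (p, v) = affine_line z by exists (p, v).
by exists (Line h).
Qed.

Lemma line_unit_direction l :
  exists p d, dot d d = 1 /\ line_set l = affine_line (p, d).
Proof.
case: l => /= L [[p v] /= v0 ->].
have n0 : enorm v != 0 by rewrite sqrtr_eq0 -ltNge dot_gt0.
exists p, ((enorm v)^-1 *: v); split.
  by rewrite !dotE -enorm_sqr; field.
have := affine_line_reparam p ((enorm v)^-1 *: v) 0 n0.
by rewrite scale0r addr0 scalerA mulfV// scale1r.
Qed.

Lemma tangent_atP l p0 v c p : line_set l = affine_line (p0, v) -> v != 0 ->
  tangent_at l (eball c 1) p <->
  [/\ line_set l p, dot (c - p) (c - p) = 1 & dot (c - p) v = 0].
Proof.
move=> lE v0; have vv : 0 < dot v v by rewrite dot_gt0.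
have on s : line_set l p -> line_set l (p + s *: v).
  rewrite lE => -[t _ <-] /=; exists (t + s) => //=.
  by rewrite scalerDl addrA.
have dE s : dot (p + s *: v - c) (p + s *: v - c) =
    dot (c - p) (c - p) - 2 * s * dot (c - p) v + s ^+ 2 * dot v v.
  rewrite (_ : p + s *: v - c = s *: v - (c - p)); last first.
    by rewrite opprB [RHS]addrCA addrA.
  by move: (c - p) => n; rewrite !dotE (dotC v n); ring.
rewrite /tangent_at; split.
  move=> e.
  have [lp Xp] : (line_set l `&` eball c 1) p by rewrite e.
  have inX s : dot (p + s *: v - c) (p + s *: v - c) <= 1 -> s = 0.
    move=> /eball1E h; have : (line_set l `&` eball c 1) (p + s *: v).
      by split => //; exact: on.
    rewrite e /= => /(canRL (addKr _)); rewrite addNr => /eqP.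
    by rewrite scaler_eq0 (negPf v0) orbF => /eqP.
  move/eball1E : Xp; rewrite dot_subC => le1.
  (* The point tried is the reflection of [p] in the foot of the perpendicular from [c]. It is as
     close to [c] as [p], so it must be [p]. *)
  have n0 : dot (c - p) v = 0.
    have /inX : dot (p + (2 * dot (c - p) v / dot v v) *: v - c)
                (p + (2 * dot (c - p) v / dot v v) *: v - c) <= 1.
      by rewrite dE (_ : _ + _ = dot (c - p) (c - p)) //; field; rewrite gt_eqF.
    move=> /eqP; rewrite mulf_eq0 invr_eq0 (gt_eqF vv) orbF mulf_eq0.
    by rewrite pnatr_eq0 /= => /eqP.
  split=> //; apply/eqP; rewrite eq_le le1 /= leNgt; apply/negP => lt1.
  (* Were [p] interior, it would be the midpoint of a chord, and half a chord further the sphere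
     gives a second common point. *)
  have /inX/eqP : dot (p + Num.sqrt ((1 - dot (c - p) (c - p)) / dot v v) *: v - c)
              (p + Num.sqrt ((1 - dot (c - p) (c - p)) / dot v v) *: v - c) <= 1.
    rewrite dE n0 sqr_sqrtr; last by rewrite divr_ge0 ?ltW// subr_gt0.
    by rewrite mulr0 subr0 divfK ?gt_eqF// addrC subrK.
  by rewrite sqrtr_eq0 leNgt divr_gt0// subr_gt0.
move=> [lp n1 n0]; apply/seteqP; split=> [x [lx /eball1E]|_ ->]; last first.
  by split=> //; apply/eball1E; rewrite dot_subC n1.
have [s ->] : exists s : R, x = p + s *: v.
  move: lp lx; rewrite lE => -[t _ /= <-] [s _ /= <-].
  by exists (s - t); rewrite -addrA -scalerDl; congr (_ + _ *: _); ring.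
rewrite dE n1 n0 => h; have : s ^+ 2 * dot v v <= 0 by lra.
rewrite pmulr_lle0 // => s0; suff -> : s = 0 by rewrite scale0r addr0.
by apply/eqP; rewrite -sqrf_eq0 eq_le s0 sqr_ge0.
Qed.

(** By Pythagoras at the contact point, a tangent line stays outside the open ball. Lines entering
    all the open balls thus satisfy the contact clause of [line_transversal] for free. *)
Lemma interior_not_tangent l c x p : line_set l x -> dot (x - c) (x - c) < 1 ->
  ~ tangent_at l (eball c 1) p.
Proof.
move=> lx xc; have [p0 [d [d1 lE]]] := line_unit_direction l.
have d0 : d != 0 by rewrite -dot_gt0 d1.
move=> /(tangent_atP _ _ lE d0)[].
move: lx xc; rewrite lE => -[s _ /= <-] + [t _ /= <-].
set n := c - _; have -> : p0 + s *: d - c = (s - t) *: d - n.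
  by rewrite /n; apply: row3P; rewrite !mxE; ring.
move: n => n; rewrite !dotE (dotC d n) => + n1 n0; rewrite n0 n1 d1.
by have := sqr_ge0 (s - t); rewrite expr2; lra.
Qed.

End Lines.

(** * Pinned lines do not deform *)

Section Pinning.
Variable R : realType.
Implicit Types (p v c d x q w : 'rV[R]_3) (l m : line R).

Lemma cvg_affine p q : p + e *: q @[e --> (0 : R)] --> p.
Proof.
rewrite -[X in _ --> X]addr0 -(scale0r q).
by apply: cvgD; [exact: cvg_cst | apply: cvgZl; exact: cvg_id].
Qed.

(** The quadratic is the squared distance from a centre to a point of the displaced line: it starts
    below 1, or at 1 with negative slope. *)
Lemma quadratic_lt1_near0 (a b g : R) : 0 <= b -> g < 1 \/ (g = 1 /\ 0 < a) ->
  \forall e \near (0 : R)^'+, g - 2 * e * a + e ^+ 2 * b < 1.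
Proof.
move=> b0 h.
(* The bound by 1 gives [e ^+ 2 <= e] in the first case; in the second, [e * b < a] lets the linear
   term win. *)
pose e0 := if g < 1 then Num.min 1 ((1 - g) / (1 + 2 * `|a| + b))
           else a / (1 + b).
have d0 : 0 < 1 + 2 * `|a| + b by have := normr_ge0 a; lra.
have d1 : 0 < 1 + b by lra.
have e00 : 0 < e0.
  rewrite /e0; case: ifPn => [g1|]; last first.
    case: h => [->//|[_ a0] _]; exact: divr_gt0.
  by rewrite lt_min ltr01 divr_gt0 // subr_gt0.
near=> e.
have ep : 0 < e by near: e; exact: nbhs_right_gt.
have : e < e0 by near: e; exact: nbhs_right_lt.
rewrite /e0; case: ifPn => [g1|ng].
  rewrite lt_min => /andP[e1]; rewrite ltr_pdivlMr // => ee.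
  have ea : e * - a <= e * `|a| by rewrite ler_pM2l// -normrN ler_norm.
  have eb : e * (e * b) <= e * b by rewrite ler_pM2l// ler_piMl// ltW.
  rewrite expr2; lra.
case: h => [g1|[-> a0]]; first by rewrite g1 in ng.
rewrite ltr_pdivlMr // => ee; nra.
Unshelve. all: by end_near. Qed.

(** The conclusion is not a contradiction because the displacement may merely slide or rescale the
    parametrization of [l]. *)
Lemma pins_near_transversal (F : set (set 'rV[R]_3)) l p d q w :
  pins F l -> line_set l = affine_line (p, d) -> d != 0 ->
  (\forall e \near (0 : R)^'+, forall m,
     line_set m = affine_line (p + e *: q, d + e *: w) -> line_transversal F m) ->
  exists2 e : R, 0 < e &
    line_set l = affine_line (p + e *: q, d + e *: w).
Proof.
move=> [_ [V nV VE]] lE d0 tr.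
move: nV; rewrite nbhsE => -[U [oU Ul] UV].
have oP : open (line_params U) by exact: oU.
have Pl : line_params U (p, d) by split => //; exists l.
have cv : (p + e *: q, d + e *: w) @[e --> (0 : R)] --> (p, d).
  by apply: (@cvg_pair _ _ _ _ (nbhs p) (nbhs d)); exact: cvg_affine.
have nU : \forall e \near (0 : R)^'+, line_params U (p + e *: q, d + e *: w).
  exact: (cvg_at_right_filter cv) (open_nbhs_nbhs (conj oP Pl)).
have [e [[_ [m Um mE]] em e0]] : exists e : R,
    [/\ line_params U (p + e *: q, d + e *: w),
      forall m, line_set m = affine_line (p + e *: q, d + e *: w) ->
        line_transversal F m & 0 < e].
  apply: (@filter_ex _ (0 : R)^'+ _).
  near=> e; split; [near: e; exact: nU|near: e; exact: tr|].
  by near: e; exact: nbhs_right_gt.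
exists e => //; have : (V `&` [set m | line_transversal F m]) m.
  by split; [exact: UV|exact: em].
by rewrite VE /= => <-.
Unshelve. all: by end_near. Qed.

(** The vector [n i] goes from the foot of the perpendicular on [l] to the centre, and
    [q + z i *: w] is the velocity of that foot. A tangent ball is entered when the two form an
    acute angle. *)
Lemma pins_deformation (I : finType) (c : I -> 'rV[R]_3) l p d q w :
  pins (range (fun i => eball (c i) 1)) l ->
  line_set l = affine_line (p, d) -> dot d d = 1 ->
  let z i := dot (c i - p) d in let n i := c i - p - z i *: d in
  (forall i, dot (n i) (n i) < 1 \/
     (dot (n i) (n i) = 1 /\ 0 < dot (n i) (q + z i *: w))) ->
  exists2 e : R, 0 < e &
    line_set l = affine_line (p + e *: q, d + e *: w).
Proof.
move=> pl lE d1 z n h; apply: (pins_near_transversal pl lE).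
  by rewrite -dot_gt0 d1.
have near_all : \forall e \near (0 : R)^'+, forall i,
    dot (n i) (n i) - 2 * e * dot (n i) (q + z i *: w) +
    e ^+ 2 * dot (q + z i *: w) (q + z i *: w) < 1.
  by apply: filter_forall => i; apply: quadratic_lt1_near0; rewrite ?dot_ge0.
near=> e => m mE.
have inner i : exists2 x, line_set m x & dot (x - c i) (x - c i) < 1.
  exists (p + e *: q + z i *: (d + e *: w)).
    by rewrite mE; exact: mem_affine_line.
  rewrite (_ : _ - c i = e *: (q + z i *: w) - n i); last first.
    by rewrite /n; apply: row3P; rewrite !mxE; ring.
  have : dot (n i) (n i) - 2 * e * dot (n i) (q + z i *: w) +
    e ^+ 2 * dot (q + z i *: w) (q + z i *: w) < 1.
    by move: i; near: e.
  move: (n i) (q + z i *: w) => ni y; rewrite !dotE (dotC y ni).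
  by congr (_ < _); ring.
split=> [_ [i _ <-]|_ Y x [i _ <-] _ _ [+ _]].
  have [x mx xc] := inner i; exists x; split=> //.
  by apply/eball1E; exact: ltW.
by have [y my yc] := inner i; exact: interior_not_tangent my yc.
Unshelve. all: by end_near. Qed.

End Pinning.

(** * Neighbourhoods of a line, and triples of balls on alternating sides *)

Section AlternatingTriple.
Variable R : realType.
Implicit Types (p v c d x q w : 'rV[R]_3) (l m : line R).

Lemma continuous_dot (T : topologicalType) (f g : T -> 'rV[R]_3) :
  continuous f -> continuous g -> continuous (fun t => dot (f t) (g t)).
Proof.
move=> cf cg; rewrite (_ : (fun _ => _) = (fun t => f t 0 0 * g t 0 0 +
  f t 0 1 * g t 0 1 + f t 0 2 * g t 0 2)); last by apply/funext => t; rewrite dot3E.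
have cc (h : T -> 'rV[R]_3) i : continuous h -> continuous (fun t => h t 0 i).
  move=> ch t; apply: (@continuous_comp _ _ _ h (fun M : 'rV[R]_3 => M 0 i)).
    exact: ch.
  exact: (@coord_continuous R 1 3).
by move=> t; apply: cvgD; [apply: cvgD|]; apply: cvgM; exact: cc.
Qed.

(* Lines close to the line through [p] with unit direction [d], written with the unique
   parameters such that [q] and [w] are orthogonal to [d]. *)
Definition line_tube p d (r : R) : set (line R) :=
  [set m | exists q w, [/\ dot q d = 0, dot w d = 0, dot q q < r ^+ 2,
     dot w w < r ^+ 2 & line_set m = affine_line (p + q, d + w)]].

(** Normalizing a pair [(p', v)] divides by [s = dot v d]. The vectors [fw] and [fq] are the
    normalized [w] and [q] times [s], so the tube is cut out by strict inequalities between
    continuous functions. *)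
Lemma open_line_tube p d r : dot d d = 1 -> open (line_tube p d r).
Proof.
move=> d1.
pose s (z : 'rV[R]_3 * 'rV[R]_3) := dot z.2 d.
pose fw z : 'rV[R]_3 := z.2 - s z *: d.
pose fq z : 'rV[R]_3 := s z *: (z.1 - p) - dot (z.1 - p) d *: z.2.
have params_eq : line_params (line_tube p d r) =
    [set z | dot (fw z) (fw z) < r ^+ 2 * (s z * s z)] `&`
    [set z | dot (fq z) (fq z) < r ^+ 2 * (s z * s z)].
  apply/seteqP; split=> [[p' v] /= [v0 [m [q [w [qd wd qr wr mE]]]]]|[p' v] /= []].
    rewrite mE => /esym/affine_line_eq[t [k [-> vE]]]; move: v0.
    rewrite {}vE => kv.
    have k0 : k != 0 by apply: contraNneq kv => ->; rewrite scale0r.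
    have k2 : 0 < k * k by rewrite -expr2 lt0r sqrf_eq0 k0 sqr_ge0.
    have sE : s (p + q + t *: (d + w), k *: (d + w)) = k.
      by rewrite /s /= !dotE d1 wd addr0 mulr1.
    have fwE : fw (p + q + t *: (d + w), k *: (d + w)) = k *: w.
      by rewrite /fw sE /=; apply: row3P; rewrite !mxE; ring.
    have fqE : fq (p + q + t *: (d + w), k *: (d + w)) = k *: q.
      rewrite /fq sE /= (_ : p + q + _ - p = q + t *: (d + w)); last first.
        by apply: row3P; rewrite !mxE; ring.
      rewrite !dotE d1 wd qd addr0 mulr1 add0r.
      by apply: row3P; rewrite !mxE; ring.
    have scale a : a < r ^+ 2 -> k * (k * a) < r ^+ 2 * (k * k).
      by move=> ar; rewrite mulrA mulrC ltr_pM2r.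
    by rewrite fwE fqE sE !dotE; split; exact: scale.
  set k := s (p', v) => hw hq.
  (* The strict inequality itself excludes [k = 0], since its right side would then vanish. *)
  have k0 : k != 0.
    by apply/eqP => k0; move: hw; rewrite k0 !mulr0 ltNge dot_ge0.
  have k2 : 0 < k * k by rewrite -expr2 lt0r sqrf_eq0 k0 sqr_ge0.
  have scale a : a < r ^+ 2 * (k * k) -> k^-1 * (k^-1 * a) < r ^+ 2.
    by move=> ar; rewrite mulrA -invfM mulrC ltr_pdivrMr.
  have vE : v = k *: (d + k^-1 *: fw (p', v)).
    by rewrite /fw -/k /=; apply: row3P; rewrite !mxE; field.
  have v0 : v != 0.
    by apply/eqP => v0; move: k0; rewrite /k /s /= v0 dot0l eqxx.
  split=> //; have [m mE] := mk_line p' v0; exists m => //.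
  exists (k^-1 *: fq (p', v)), (k^-1 *: fw (p', v)); split.
  - by rewrite /fq -/k /= !dotE -[dot v d]/k; ring.
  - by rewrite /fw -/k /= !dotE -[dot v d]/k d1; ring.
  - by rewrite dotZl dotZr; exact: scale.
  - by rewrite dotZl dotZr; exact: scale.
  rewrite mE; set t := dot (p' - p) d.
  (* The base point slides to height 0 and the direction is scaled to have component 1 along [d]. *)
  rewrite -(@affine_line_reparam _ p' v (- (t / k)) k^-1) ?invr_eq0//.
  congr (affine_line (_, _)).
    by rewrite /fq -/k -/t /=; apply: row3P; rewrite !mxE; field.
  by rewrite {1}vE scalerA mulVf// scale1r.
have cs : continuous s.
  by apply: continuous_dot => z; [exact: cvg_snd | exact: cvg_cst].
have cZ (f : 'rV[R]_3 * 'rV[R]_3 -> R) (g : 'rV[R]_3 * 'rV[R]_3 -> 'rV[R]_3) :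
    continuous f -> continuous g -> continuous (fun z => f z *: g z).
  by move=> cf cg z; exact: (cvgZ (cf z) (cg z)).
have cB (f g : 'rV[R]_3 * 'rV[R]_3 -> 'rV[R]_3) :
    continuous f -> continuous g -> continuous (fun z => f z - g z).
  by move=> cf cg z; exact: (cvgB (cf z) (cg z)).
have c1 : continuous (fun z : 'rV[R]_3 * 'rV[R]_3 => z.1 - p).
  by apply: cB => z; [exact: cvg_fst | exact: cvg_cst].
have c2 : continuous (fun z : 'rV[R]_3 * 'rV[R]_3 => z.2).
  by move=> z; exact: cvg_snd.
have cd : continuous (fun _ : 'rV[R]_3 * 'rV[R]_3 => d).
  by move=> z; exact: cvg_cst.
have cfw : continuous fw := cB _ _ c2 (cZ _ _ cs cd).
have cfq : continuous fq := cB _ _ (cZ _ _ cs c1)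
  (cZ _ _ (continuous_dot c1 cd) c2).
have oS f : continuous f -> open [set z | dot (f z) (f z) < r ^+ 2 * (s z * s z)].
  move=> cf; rewrite (_ : [set _ | _] =
      (fun z => dot (f z) (f z) - r ^+ 2 * (s z * s z)) @^-1` [set t | t < 0]).
    apply: open_comp; last exact: open_lt.
    move=> z _; apply: cvgB; first exact: continuous_dot.
    by apply: cvgM; [exact: cvg_cst | apply: cvgM; exact: cs].
  by apply/seteqP; split=> z /=; rewrite subr_lt0.
have : open (line_params (line_tube p d r)) by rewrite params_eq; apply: openI; exact: oS.
by [].
Qed.

(* For a line through [p + q] with direction [d + w], the three balls force the affine
   function [t |-> dot n q + t * dot n w] to be [>= 0], [<= 0], [>= 0] at
   three increasing parameters; hence it vanishes and the line meets each ball at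
   a point of its axis only. *)
Lemma pins_alternating_triple l p d n (F : set (set 'rV[R]_3)) (z1 z2 z3 : R) :
  line_set l = affine_line (p, d) -> dot d d = 1 -> dot n n = 1 -> dot n d = 0 ->
  z1 < z2 -> z2 < z3 ->
  F (eball (p + z1 *: d + n) 1) -> F (eball (p + z2 *: d - n) 1) ->
  F (eball (p + z3 *: d + n) 1) ->
  line_transversal F l -> pins F l.
Proof.
move=> lE d1 n1 nd z12 z23 F1 F2 F3 tl; split; first exact/mem_set.
(* Parameters within [h] of the three heights keep their order. *)
pose h := Num.min (z2 - z1) (z3 - z2) / 2.
have h0 : 0 < h by rewrite divr_gt0 // lt_min !subr_gt0 z12 z23.
have h12 : 2 * h <= z2 - z1 by rewrite mulrC divfK ?pnatr_eq0// ge_min lexx.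
have h23 : 2 * h <= z3 - z2 by rewrite mulrC divfK ?pnatr_eq0// ge_min lexx orbT.
pose M := `|z1| + `|z2| + `|z3| + 2.
have M2 : 2 <= M by rewrite lerDr !addr_ge0.
(* All relevant parameters satisfy [|t| <= M - 1], so [2 * |dot n q + t * dot n w|] is at most
   [2 * r * M], which is half of [h ^+ 2]. *)
pose r := h ^+ 2 / (4 * M).
have M4 : 0 < 4 * M by lra.
have r0 : 0 < r by rewrite divr_gt0 // exprn_gt0.
have rM : r * (4 * M) = h ^+ 2 by rewrite divfK ?gt_eqF.
have tubel : line_tube p d r l.
  by exists 0, 0; split; rewrite ?dot0l ?exprn_gt0// !addr0.
exists (line_tube p d r).
  by apply: open_nbhs_nbhs; split=> //; exact: open_line_tube.
apply/seteqP; split=> [m [[q [w [qd wd qr wr mE]]] [mF _]]|_ ->]; last by split.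
have small x : dot x x < r ^+ 2 -> `|dot n x| < r.
  move=> xr; rewrite -(ltr_pXn2r (_ : 0 < 2)%N) ?nnegrE ?(ltW r0)//.
  rewrite -normrX ger0_norm ?sqr_ge0//; apply: le_lt_trans (dot_CS _ _) _.
  by rewrite n1 mul1r.
(* Here [e] records the side of the ball. Expanding the squared distance to its centre bounds both
   [(t - zk) ^+ 2] and the squared norm of [q + t *: w] by the right side. *)
have key e zk : e = 1 \/ e = -1 -> `|zk| <= M - 2 -> F (eball (p + zk *: d + e *: n) 1) ->
    exists2 t, `|t - zk| < h &
      dot (q + t *: w) (q + t *: w) <= 2 * e * (dot n q + t * dot n w).
  move=> e1 zM Fk.
  have [x [mx /eball1E xk]] := mF _ Fk; move: mx xk; rewrite mE.
  move=> [t _ /= <-].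
  rewrite (_ : p + q + t *: (d + w) - _ = (q + t *: w - e *: n) + (t - zk) *: d);
    last by apply: row3P; rewrite !mxE; ring.
  have perp : dot (q + t *: w - e *: n) d = 0 by rewrite !dotE qd wd nd; ring.
  rewrite dotDl (dotDr _ _ (_ - _)) (dotDr _ _ (_ *: d)) !dotZl !dotZr d1.
  rewrite (dotC d) perp; have := dot_ge0 (q + t *: w - e *: n).
  have -> : dot (q + t *: w - e *: n) (q + t *: w - e *: n) =
      dot (q + t *: w) (q + t *: w) - 2 * e * (dot n q + t * dot n w) + 1.
    by rewrite !dotE (dotC q n) (dotC w n) (dotC w q) n1; case: e1 => ->; ring.
  have := dot_ge0 (q + t *: w) => Y0 g0 g1.
  have t2 : (t - zk) ^+ 2 <= 2 * e * (dot n q + t * dot n w) by rewrite expr2; lra.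
  have tle : `|t - zk| <= 1.
    rewrite -(ler_pXn2r (_ : 0 < 2)%N) ?nnegrE// expr1n -normrX.
    by rewrite ger0_norm ?sqr_ge0// expr2; lra.
  have tM : `|t| <= M - 1.
    by have := ler_normD (t - zk) zk; rewrite subrK; lra.
  exists t; last by have := sqr_ge0 (t - zk); rewrite expr2; lra.
  rewrite -(ltr_pXn2r (_ : 0 < 2)%N) ?nnegrE ?(ltW h0)//.
  rewrite -normrX ger0_norm ?sqr_ge0//; apply: (le_lt_trans t2).
  have nq := small _ qr; have nw := small _ wr.
  have le : e * (dot n q + t * dot n w) <= r * M.
    apply: (le_trans (ler_norm _)); rewrite normrM.
    have -> : `|e| = 1 by case: e1 => ->; rewrite ?normrN normr1.
    rewrite mul1r; apply: (le_trans (ler_normD _ _)); rewrite normrM.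
    have : `|t| * `|dot n w| <= (M - 1) * r by rewrite ler_pM // ltW.
    lra.
  have := exprn_gt0 2 h0; rewrite -rM; lra.
have [t1 t1z k1] : exists2 t, `|t - z1| < h &
      dot (q + t *: w) (q + t *: w) <= 2 * 1 * (dot n q + t * dot n w).
  apply: key; [by left| |by rewrite scale1r].
  by rewrite addrK -addrA lerDl addr_ge0.
have [t2 t2z k2] : exists2 t, `|t - z2| < h &
      dot (q + t *: w) (q + t *: w) <= 2 * -1 * (dot n q + t * dot n w).
  apply: key; [by right| |by rewrite scaleN1r].
  by rewrite addrK addrAC lerDr addr_ge0.
have [t3 t3z k3] : exists2 t, `|t - z3| < h &
      dot (q + t *: w) (q + t *: w) <= 2 * 1 * (dot n q + t * dot n w).
  apply: key; [by left| |by rewrite scale1r].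
  by rewrite addrK lerDr addr_ge0.
have t12 : t1 < t2.
  by move: t1z t2z; rewrite !ltr_norml => /andP[_ ?] /andP[? _]; lra.
have t23 : t2 < t3.
  by move: t2z t3z; rewrite !ltr_norml => /andP[_ ?] /andP[? _]; lra.
have := dot_ge0 (q + t1 *: w); have := dot_ge0 (q + t2 *: w).
have := dot_ge0 (q + t3 *: w).
move: (dot n q) (dot n w) k1 k2 k3 => a b k1 k2 k3 s3 s2 s1.
(* The alternating signs bound the slope on both sides; afterwards the norms in [k1] and [k2] vanish
   too, which gives two zeros of [q + t *: w]. *)
have b0 : b = 0.
  by apply/eqP; rewrite eq_le; apply/andP; split; nra.
have a0 : a = 0 by move: k1 k2 k3; rewrite b0; lra.
move: k1 k2; rewrite a0 b0 !mulr0 !addr0 !mulr0 => k1 k2.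
have /eqP q1 : q + t1 *: w == 0 by rewrite -dot_eq0 eq_le k1 s1.
have /eqP q2 : q + t2 *: w == 0 by rewrite -dot_eq0 eq_le k2 s2.
have /eqP : (t2 - t1) *: w = 0.
  have -> : (t2 - t1) *: w = (q + t2 *: w) - (q + t1 *: w).
    by apply: row3P; rewrite !mxE; ring.
  by rewrite q1 q2 subrr.
rewrite scaler_eq0 subr_eq0 gt_eqF //= => /eqP w0.
move: q1; rewrite w0 scaler0 addr0 => q0.
by apply: line_set_inj; rewrite mE lE q0 w0 !addr0.
Qed.

End AlternatingTriple.

(** * The paraboloid *)

Section Frame.
Variable R : realType.
Implicit Types (x y e : 'rV[R]_3).

(** The frame forms the rows of [Q], as coordinates are row vectors acting from the left. The
    expansion of [x] holds because a one-sided inverse of a square matrix is two-sided. *)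
Lemma orthonormal_frame e0 e1 e2 :
  dot e0 e0 = 1 -> dot e1 e1 = 1 -> dot e2 e2 = 1 ->
  dot e0 e1 = 0 -> dot e0 e2 = 0 -> dot e1 e2 = 0 ->
  exists Q : 'M[R]_3, [/\ Q *m Q^T = 1%:M,
    forall y, y *m Q = y 0 0 *: e0 + y 0 1 *: e1 + y 0 2 *: e2 &
    forall x, x = dot x e0 *: e0 + dot x e1 *: e1 + dot x e2 *: e2].
Proof.
move=> h00 h11 h22 h01 h02 h12.
pose e (i : 'I_3) := if i == 0 then e0 else if i == 1 then e1 else e2.
pose Q := \matrix_(i < 3, j < 3) e i 0 j.
have sumE (f : 'I_3 -> R) : \sum_i f i = f 0 + f 1 + f 2.
  rewrite !big_ord_recl big_ord0 addr0 addrA.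
  by congr (_ + f _ + f _); apply: val_inj.
have QQ : Q *m Q^T = 1%:M.
  apply/matrixP => i j; rewrite mxE sumE !mxE -dot3E.
  have case3 (k : 'I_3) : [\/ k = 0, k = 1 | k = 2].
    case: k => -[|[|[|//]]] k3; [apply: Or31|apply: Or32|apply: Or33];
    exact: val_inj.
  by case: (case3 i) => ->; case: (case3 j) => ->; rewrite /e /= ?(dotC e2) ?(dotC e1 e0).
have yQ y : y *m Q = y 0 0 *: e0 + y 0 1 *: e1 + y 0 2 *: e2.
  by apply/rowP => j; rewrite mxE sumE !mxE /e.
exists Q; split=> // x.
have -> : dot x e0 *: e0 + dot x e1 *: e1 + dot x e2 *: e2 = x *m Q^T *m Q.
  rewrite yQ.
  have xQ i : (x *m Q^T) 0 i = dot x (e i) by rewrite mxE sumE !mxE dot3E.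
  by rewrite !xQ.
by rewrite -mulmxA (mulmx1C QQ) mulmx1.
Qed.

End Frame.

(** * Equation, rulings, sides and normals of the paraboloid *)

Section Paraboloid.
Variables (R : realType) (p d A B : 'rV[R]_3).
Hypotheses (d1 : dot d d = 1) (Ad : dot A d = 0) (Bd : dot B d = 0).
Hypothesis AB : dot A (cross d B) != 0.
Implicit Types (x y : 'rV[R]_3) (z : R).

(** The normal of the surface at height [z] on the axis. By [AB], the vectors [A] and [B] are
    independent, so it never vanishes. *)
Definition parab_normal z := A + z *: B.

Definition parab_fun x := dot (parab_normal (dot (x - p) d)) (x - p).

Definition paraboloid : set 'rV[R]_3 := [set x | parab_fun x = 0].

Definition parab_rulings : set (line R) :=
  [set m | exists z, line_set m = affine_line (p + z *: d, cross d (parab_normal z))].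

Lemma parab_normal_neq0 z : parab_normal z != 0.
Proof.
apply/eqP => /(canRL (addrK _)) AE; move: AB.
by rewrite AE sub0r !dotE (dotC B) dot_crossr mulr0 oppr0 eqxx.
Qed.

Lemma parab_normal_perp z : dot (parab_normal z) d = 0.
Proof. by rewrite !dotE Ad Bd mulr0 addr0. Qed.

Lemma ruling_direction z : 0 < dot (cross d (parab_normal z)) (cross d (parab_normal z)).
Proof.
rewrite dot_cross d1 mul1r (dotC d) parab_normal_perp expr0n subr0.
by rewrite dot_gt0 parab_normal_neq0.
Qed.

Lemma mem_ruling x z : dot (x - (p + z *: d)) d = 0 ->
  dot (x - (p + z *: d)) (parab_normal z) = 0 ->
  affine_line (p + z *: d, cross d (parab_normal z)) x.
Proof.
move=> xd xN; have cc := ruling_direction z; have := perp_cross xd xN.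
set c := cross _ _; set y := x - _ => e.
exists (dot y c / dot c c) => //=; rewrite mulrC -scalerA -e scalerA.
by rewrite mulVf ?gt_eqF// scale1r addrC subrK.
Qed.

(** Each slice orthogonal to [d] is a single line, so the height of a point along [d] determines its
    ruling. *)
Lemma ruling_family_paraboloid : ruling_family paraboloid parab_rulings.
Proof.
have height z t : dot (p + z *: d + t *: cross d (parab_normal z) - p) d = z.
  rewrite (_ : _ - p = z *: d + t *: cross d (parab_normal z)); last first.
    by rewrite addrC -addrA addKr.
  by rewrite dotDl !dotZl dot_crossl d1 mulr1 mulr0 addr0.
split; last first.
  move=> l m [z lE] [z' mE] [x []]; rewrite lE mE => -[t _ /= <-] [t' _ /= e].
  have zz : z = z' by rewrite -(height z t) -e height.
  by apply: line_set_inj; rewrite lE mE zz.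
apply/seteqP; split=> [x Hx|x [m [z mE]]].
  set z := dot (x - p) d.
  have c0 : cross d (parab_normal z) != 0 by rewrite -dot_gt0 ruling_direction.
  have [m mE] := mk_line (p + z *: d) c0.
  exists m; first by exists z.
  have xE : x - (p + z *: d) = (x - p) - z *: d by rewrite opprD addrA.
  rewrite mE; apply: mem_ruling; rewrite xE (dotDl (x - p)) dotNl dotZl.
    by rewrite d1 mulr1 subrr.
  rewrite (dotC (x - p)) -[dot _ (x - p)]/(parab_fun x) Hx.
  by rewrite (dotC d) parab_normal_perp mulr0 subrr.
rewrite mE => -[t _ /= <-]; rewrite /paraboloid /= /parab_fun height.
rewrite (_ : _ - p = z *: d + t *: cross d (parab_normal z)); last first.
  by rewrite addrC -addrA addKr.
by rewrite dotDr !dotZr parab_normal_perp dotC dot_crossr !mulr0 addr0.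
Qed.

(** In coordinates along [b], [d] and [u], the equation is a product of the first two plus linear
    terms; a rotation by 45 degrees makes the product a difference of squares. *)
Lemma hyperbolic_paraboloidP : hyperbolic_paraboloid paraboloid.
Proof.
have B0 : B != 0.
  apply: contraNneq AB => ->; rewrite (_ : cross d 0 = 0) ?dot0r//.
  by apply: row3P; rewrite /cross !mxE /=; ring.
set nB := enorm B; have nB0 : 0 < nB by rewrite sqrtr_gt0 dot_gt0.
have [b [BE b1 bd]] : exists b, [/\ B = nB *: b, dot b b = 1 & dot b d = 0].
  exists (nB^-1 *: B); split; first by rewrite scalerA mulfV ?gt_eqF// scale1r.
    by rewrite dotZl dotZr -enorm_sqr -/nB; field; rewrite gt_eqF.
  by rewrite dotZl Bd mulr0.
(* The sign of [u] is chosen to make [- (2 * be) / nB], the common squared scale of the normal form,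
   positive. *)
have [u [u1 ud ub Au]] : exists u, [/\ dot u u = 1, dot u d = 0, dot u b = 0 & dot A u < 0].
  have c1 : dot (cross d b) (cross d b) = 1.
    by rewrite dot_cross d1 b1 (dotC d) bd; ring.
  have Ac : dot A (cross d b) != 0.
    apply: contraNneq AB => h; rewrite BE.
    rewrite (_ : cross d (nB *: b) = nB *: cross d b) ?dotZr ?h ?mulr0//.
    by apply: row3P; rewrite /cross !mxE /=; ring.
  have [Ac0|Ac0|/eqP] := ltgtP (dot A (cross d b)) 0; last by rewrite (negPf Ac).
    by exists (cross d b); rewrite dot_crossl dot_crossr.
  exists (- cross d b); rewrite !dotE dot_crossl dot_crossr c1 opprK oppr0.
  by rewrite oppr_lt0.
set be := dot A u in Au; set al := dot A b.
(* The factor that normalizes [b + d] and [b - d]. *)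
pose r := Num.sqrt (2^-1 : R).
have rr : r * r = 2^-1 by rewrite -expr2 sqr_sqrtr.
have [||||||Q [QQ yQ xQ]] :=
    @orthonormal_frame R (r *: (b + d)) (r *: (b - d)) u.
- by rewrite !dotE (dotC d b) bd b1 d1; move: rr; lra.
- by rewrite !dotE (dotC d b) bd b1 d1; move: rr; lra.
- exact: u1.
- by rewrite !dotE (dotC d b) bd b1 d1; ring.
- by rewrite !dotE (dotC d) (dotC b) ud ub; ring.
- by rewrite !dotE (dotC d) (dotC b) ud ub; ring.
(* This shift along the axis absorbs the linear term [al] along [b] into the product. *)
pose o := p - (al / nB) *: d.
have a20 : 0 < - (2 * be) / nB by rewrite divr_gt0 // oppr_gt0 pmulr_rlt0.
pose a := Num.sqrt (- (2 * be) / nB).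
have a0 : 0 < a by rewrite sqrtr_gt0.
have a2 : a ^+ 2 = - (2 * be) / nB by rewrite sqr_sqrtr // ltW.
have funE y : parab_fun (y *m Q + o) =
    be * (y 0 2 - ((y 0 0 / a) ^+ 2 - (y 0 1 / a) ^+ 2)).
  rewrite !exprMn !exprVn a2 yQ /o.
  set s0 := y 0 0; set s1 := y 0 1; set s2 := y 0 2.
  rewrite /parab_fun /parab_normal.
  rewrite (_ : _ + (p - _) - p = (r * (s0 + s1)) *: b +
      (r * (s0 - s1) - al / nB) *: d + s2 *: u); last first.
    by apply: row3P; rewrite !mxE; ring.
  have Bb : dot B b = nB by rewrite BE dotZl b1 mulr1.
  have Bu : dot B u = 0 by rewrite BE dotZl dotC ub mulr0.
  rewrite !dotE -/al -/be d1 bd ud Ad Bb Bu Bd.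
  have -> : be * (s2 - (s0 ^+ 2 * (- (2 * be) / nB)^-1 - s1 ^+ 2 * (- (2 * be) / nB)^-1))
    = be * s2 + 2^-1 * nB * (s0 ^+ 2 - s1 ^+ 2).
    by field; rewrite gt_eqF ?lt_eqF.
  by rewrite -rr; field; rewrite gt_eqF.
exists Q, o, a, a; split=> //; apply/seteqP; split=> [x|_ [y /= yE <-]]; last first.
  by rewrite /paraboloid /= funE yE subrr mulr0.
pose y : 'rV[R]_3 := (x - o) *m Q^T.
have xE : x = y *m Q + o by rewrite -mulmxA (mulmx1C QQ) mulmx1 subrK.
rewrite /paraboloid /= {1}xE funE => /eqP; rewrite mulf_eq0 lt_eqF //= subr_eq0.
by move=> /eqP yE; exists y.
Qed.

(** As [cross d B] is orthogonal to [d] and [B], only the term in [A] varies along it, at constant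
    rate. *)
Lemma parab_fun_step x (s : R) :
  parab_fun (x + (s / dot A (cross d B)) *: cross d B) = parab_fun x + s.
Proof.
rewrite /parab_fun /parab_normal.
rewrite (_ : x + _ - p = (x - p) + (s / dot A (cross d B)) *: cross d B); last first.
  by rewrite addrAC.
move: (x - p) => y; rewrite !dotDl !dotDr !dotZl !dotZr dot_crossl mulr0 addr0.
by rewrite (dotC B (cross d B)) dot_crossr !mulr0 addr0; field.
Qed.

Lemma continuous_parab_fun : continuous parab_fun.
Proof.
have cid : continuous (fun x : 'rV[R]_3 => x) by move=> x; exact: cvg_id.
have cst (y : 'rV[R]_3) : continuous (fun x : 'rV[R]_3 => y).
  exact: cst_continuous.
have cp : continuous (fun x : 'rV[R]_3 => x - p).
  by move=> x; exact: (cvgB (cid x) (cst p x)).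
have cd : continuous (fun x : 'rV[R]_3 => dot (x - p) d).
  exact: continuous_dot cp (cst d).
apply: (continuous_dot _ cp) => x.
exact: (cvgD (cst A x) (cvgZl (cd x))).
Qed.

(* The flow of [cross d B] shifts [parab_fun] at unit speed, which bends a segment into
   a path along which [parab_fun] is affine. *)
Lemma side_paraboloid (sg : R) : sg * sg = 1 ->
  side paraboloid [set x | 0 < sg * parab_fun x].
Proof.
move=> sg2.
pose bump s x := x + (s / dot A (cross d B)) *: cross d B.
have fb s x : parab_fun (bump s x) = parab_fun x + s by exact: parab_fun_step.
have [x0 x0p] : exists x, 0 < sg * parab_fun x.
  exists (bump (sg - parab_fun p) p); rewrite fb addrC subrK sg2; exact: ltr01.
exists x0; first by rewrite /paraboloid /= => h; rewrite h mulr0 ltxx in x0p.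
apply/seteqP; split=> x /=.
  move=> xp.
  pose seg (t : R) := x0 + t *: (x - x0).
  pose h t := parab_fun x0 + t * (parab_fun x - parab_fun x0).
  pose path t := bump (h t - parab_fun (seg t)) (seg t).
  have pathE t : parab_fun (path t) = h t by rewrite fb addrC subrK.
  have cseg : continuous seg.
    move=> t; apply: cvgD; first exact: cvg_cst.
    by apply: cvgZl; exact: cvg_id.
  have cpath : continuous path.
    move=> t; apply: cvgD; first exact: cseg.
    apply: cvgZl; apply: cvgM; last exact: cvg_cst.
    apply: cvgB; last first.
      by apply: continuous_comp; [exact: cseg | exact: continuous_parab_fun].
    apply: cvgD; first exact: cvg_cst.
    by apply: cvgM; [exact: cvg_id | exact: cvg_cst].
  apply: (@connected_component_max _ _ (path @` `[0, 1]%classic)).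
  - exists 0; first by rewrite /= in_itv /= lexx ler01.
    by rewrite /path /bump /h /seg mul0r scale0r !addr0 subrr mul0r scale0r addr0.
  - move=> _ [t /= + <-]; rewrite in_itv /= => /andP[t0 t1].
    rewrite /paraboloid /= pathE /h => h0.
    have : 0 < sg * (parab_fun x0 + t * (parab_fun x - parab_fun x0)).
      rewrite (_ : _ * _ = (1 - t) * (sg * parab_fun x0) +
        t * (sg * parab_fun x)); last by ring.
      have [->|tn0] := eqVneq t 0; first by rewrite subr0 mul1r mul0r addr0.
      apply: ltr_wpDl; first by rewrite mulr_ge0 ?subr_ge0// ltW.
      by rewrite mulr_gt0// lt0r tn0.
    by rewrite h0 mulr0 ltxx.
  - apply: connected_continuous_connected; last exact: continuous_subspaceT.
    by apply/connected_intervalP; exact: interval_is_interval.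
  - exists 1; first by rewrite /= in_itv /= lexx ler01.
    rewrite /path /seg scale1r (addrC x0) subrK /h mul1r (addrC (parab_fun x0)) subrK.
    by rewrite /bump subrr mul0r scale0r addr0.
set C := connected_component _ _ => Cx.
have subC : C `<=` ~` paraboloid by exact: connected_component_sub.
have Cx0 : C x0.
  apply: connected_component_refl => h; rewrite /paraboloid /= in h.
  by rewrite h mulr0 ltxx in x0p.
(* The image of the component is an interval with a positive element; a nonpositive one would put 0
   in it, hence a point of the surface in the component. *)
have : connected ((fun y => sg * parab_fun y) @` C).
  apply: connected_continuous_connected; first exact: component_connected.
  apply: continuous_subspaceT => y.
  have cst : continuous (fun _ : 'rV[R]_3 => sg) by exact: cst_continuous.
  exact: (cvgM (cst y) (@continuous_parab_fun y)).
move=> /connected_intervalP itv; rewrite ltNge; apply/negP => xn.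
have [y Cy /eqP] : ((fun y => sg * parab_fun y) @` C) 0.
  apply: (itv (sg * parab_fun x) (sg * parab_fun x0)); [by exists x|by exists x0|].
  by apply/andP; split=> //; exact: ltW.
have sg0 : sg != 0.
  by apply/eqP => sg0; move/eqP: sg2; rewrite sg0 mulr0 eq_sym oner_eq0.
by rewrite mulf_eq0 (negPf sg0) /= => /eqP; exact: subC.
Qed.

(** The exact Taylor expansion at a point of the axis: the gradient is [parab_normal z], and the
    remainder is quadratic. *)
Lemma parab_fun_ruling z y :
  parab_fun (p + z *: d + y) = dot (parab_normal z) y + dot y d * dot B y.
Proof.
rewrite /parab_fun (_ : _ + y - p = z *: d + y); last first.
  by rewrite addrC -addrA addKr.
by rewrite /parab_normal !dotE d1 Ad Bd; ring.
Qed.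

(** On the surface the linear term is minus the quadratic remainder, which Cauchy-Schwarz bounds by
    a multiple of the squared distance. *)
Lemma normal_at_paraboloid z k : k != 0 ->
  normal_at paraboloid (p + z *: d) (k *: parab_normal z).
Proof.
move=> k0; split.
- by rewrite /paraboloid /= -[X in parab_fun X]addr0 parab_fun_ruling !dot0r mulr0 addr0.
- by rewrite scaler_eq0 negb_or k0 parab_normal_neq0.
move=> e e0; set K := `|k| * (enorm d * enorm B).
have K0 : 0 <= K by rewrite !mulr_ge0 ?enorm_ge0.
pose r := e / (1 + K).
have r0 : 0 < r by rewrite divr_gt0 // ltr_pwDl.
pose q := p + z *: d.
have cid : continuous (fun x : 'rV[R]_3 => x) by move=> x; exact: cvg_id.
have cst : continuous (fun x : 'rV[R]_3 => q) by exact: cst_continuous.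
have cq : continuous (fun x : 'rV[R]_3 => x - q).
  by move=> x; exact: (cvgB (cid x) (cst x)).
have near_q : \forall x \near q, dot (x - q) (x - q) < r ^+ 2.
  have nb : nbhs (dot (q - q) (q - q)) [set t | t < r ^+ 2].
    apply: open_nbhs_nbhs; split; first exact: open_lt.
    by rewrite /= subrr dot0l exprn_gt0.
  exact: (continuous_dot cq cq) nb.
apply: filterS near_q => x xr Hx.
move: Hx; rewrite -/q (_ : x = q + (x - q)); last by rewrite addrC subrK.
rewrite (addrC q (x - q)) addrK; move: (x - q) xr => y yr.
rewrite (addrC y) /paraboloid /= parab_fun_ruling => /eqP; rewrite addr_eq0 => /eqP h.
rewrite dotZl h mulrN normrN !normrM.
have yn : enorm y <= r.
  by rewrite -(ler_pXn2r (_ : 0 < 2)%N) ?nnegrE ?enorm_ge0 ?(ltW r0)// enorm_sqr ltW.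
apply: (@le_trans _ _ (`|k| * ((enorm y * enorm d) * (enorm B * enorm y)))).
  by rewrite ler_pM2l ?normr_gt0// ler_pM ?normr_dot_le.
rewrite (_ : _ * (_ * _) = (K * enorm y) * enorm y); last by rewrite /K; ring.
apply: ler_wpM2r; first exact: enorm_ge0.
apply: (@le_trans _ _ (K * r)); first exact: ler_wpM2l.
have <- : r * (1 + K) = e by rewrite divfK // gt_eqF // ltr_pwDl.
by rewrite mulrDr mulr1 (mulrC K) lerDr ltW.
Qed.

(** The normal is orthogonal to [d], so the quadratic remainder vanishes and [parab_fun] is linear
    along it. *)
Lemma points_to_side_paraboloid z (k sg : R) : 0 < sg * k ->
  points_to_side (p + z *: d) (k *: parab_normal z) [set x | 0 < sg * parab_fun x].
Proof.
move=> k0; rewrite /points_to_side; near=> t.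
have t0 : 0 < t by near: t; exact: nbhs_right_gt.
rewrite /= scalerA parab_fun_ruling dotZr dotZl parab_normal_perp !(mulr0, mul0r) addr0.
rewrite (_ : _ * _ = t * (sg * k) * dot (parab_normal z) (parab_normal z)); last by ring.
by rewrite mulr_gt0 ?dot_gt0 ?parab_normal_neq0// mulr_gt0.
Unshelve. all: by end_near. Qed.

End Paraboloid.

(** * Signs and interpolation *)

Section Combinatorics.
Variable R : realType.

Lemma increasing_reindexing n (z : 'I_n -> R) : injective z ->
  exists2 s : 'I_n -> 'I_n, injective s & forall i j : 'I_n, (i < j)%N -> z (s i) < z (s j).
Proof.
case: n z => [|n] z zI; first by exists id => // -[].
pose leT (i j : 'I_n.+1) := z i <= z j.
have leT_total : total leT by move=> i j; exact: le_total.
have leT_trans : transitive leT by move=> i j k; exact: le_trans.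
pose t := sort leT (enum 'I_n.+1).
have st : size t = n.+1 by rewrite size_sort size_enum_ord.
have ut : uniq t by rewrite sort_uniq enum_uniq.
pose s (i : 'I_n.+1) := nth ord0 t i.
have sI : injective s.
  by move=> i j /eqP; rewrite nth_uniq ?st ?ltn_ord// => /eqP /val_inj.
exists s => // i j ij; rewrite lt_neqAle; apply/andP; split.
  by apply/eqP => /zI/sI e; rewrite e ltnn in ij.
apply: (sorted_ltn_nth leT_trans ord0 (sort_sorted leT_total _) i j) => //.
- by rewrite inE st.
- by rewrite inE st.
Qed.

Lemma increasing_injective n (z : 'I_n -> R) :
  (forall i j : 'I_n, (i < j)%N -> z i < z j) -> injective z.
Proof.
move=> zlt i j zij; have [ij|ji|/val_inj//] := ltngtP i j.
  by have := zlt _ _ ij; rewrite zij ltxx.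
by have := zlt _ _ ji; rewrite zij ltxx.
Qed.

(** A system orthogonal to constants and to [z] changes sign at least twice. Take [i] lowest with
    nonzero weight, then [j] lowest of opposite sign. *)
Lemma alternating_signs (I : finType) (a z : I -> R) : injective z ->
  \sum_i a i = 0 -> \sum_i a i * z i = 0 -> (exists i, a i != 0) ->
  exists i j k, [/\ z i < z j, z j < z k, a i * a j < 0 & a j * a k < 0].
Proof.
move=> zI sa saz [i0 ai0].
have [i ai imin] := @Order.TotalTheory.arg_minP _ R I i0 (fun i => a i != 0) z ai0.
have ai2 : 0 < a i * a i by rewrite -expr2 lt0r sqrf_eq0 ai sqr_ge0.
have [j0 aj0] : exists j, a i * a j < 0.
  apply: contrapT => /forallNP h; have nn j : 0 <= a i * a j.
    by rewrite leNgt; apply/negP; exact: h.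
  have : \sum_j a i * a j = 0 by rewrite -mulr_sumr sa mulr0.
  by move=> /psumr_eq0P => /(_ (fun j _ => nn j) i erefl) e; rewrite e ltxx in ai2.
have [j aj jmin] := @Order.TotalTheory.arg_minP _ R I j0 (fun j => a i * a j < 0) z aj0.
have zij : z i < z j.
  rewrite lt_neqAle imin ?andbT; last first.
    by apply: contraTneq aj => ->; rewrite mulr0 ltxx.
  by apply/eqP => /zI e; rewrite -e ltNge ltW in aj.
(* Otherwise every [a i * a k * (z j - z k)] is nonnegative; their sum is zero, yet the term at [i]
   is positive. *)
have [k [zk ak]] : exists k, z j < z k /\ 0 < a i * a k.
  apply: contrapT => /forallNP h; have nn k : 0 <= a i * a k * (z j - z k).
    have [ak|ak|->] := ltgtP (a i * a k) 0; last by rewrite mul0r.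
      by rewrite nmulr_rge0// subr_le0 jmin.
    rewrite pmulr_rge0// subr_ge0 leNgt; apply/negP => zjk.
    by apply: (h k).
  have : \sum_k a i * a k * (z j - z k) = 0.
    transitivity (a i * (z j * \sum_k a k - \sum_k a k * z k)).
      rewrite mulrBr !mulr_sumr -sumrB; apply: eq_bigr => k _.
      by ring.
    by rewrite sa saz mulr0 subr0 mulr0.
  move=> /psumr_eq0P => /(_ (fun j _ => nn j) i erefl) /eqP.
  by rewrite mulf_eq0 (gt_eqF ai2) subr_eq0 gt_eqF.
exists i, j, k; split=> //.
rewrite -(pmulr_rlt0 _ ai2); nra.
Qed.

Lemma ord4P (i : 'I_4) : [\/ i = 0, i = 1, i = 2 | i = 3].
Proof.
case: i => -[|[|[|[|//]]]] i4; [apply: Or41|apply: Or42|apply: Or43|apply: Or44];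
exact: val_inj.
Qed.

Lemma sum4E (V : zmodType) (f : 'I_4 -> V) : \sum_i f i = f 0 + f 1 + f 2 + f 3.
Proof.
rewrite !big_ord_recl big_ord0 addr0 !addrA.
by congr (_ + f _ + f _ + f _); apply: val_inj.
Qed.

(** The derivative at [z i] of the polynomial with roots [z 0], ..., [z 3]. *)
Definition nodal_prod (z : 'I_4 -> R) i := \prod_(j | j != i) (z i - z j).

Lemma nodal_prodE z : [/\ nodal_prod z 0 = (z 0 - z 1) * (z 0 - z 2) * (z 0 - z 3),
  nodal_prod z 1 = (z 1 - z 0) * (z 1 - z 2) * (z 1 - z 3),
  nodal_prod z 2 = (z 2 - z 0) * (z 2 - z 1) * (z 2 - z 3) &
  nodal_prod z 3 = (z 3 - z 0) * (z 3 - z 1) * (z 3 - z 2)].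
Proof.
have prod4E (f : 'I_4 -> R) : \prod_i f i = f 0 * f 1 * f 2 * f 3.
  rewrite !big_ord_recl big_ord0 mulr1 !mulrA.
  by congr (_ * f _ * f _ * f _); apply: val_inj.
by split; rewrite /nodal_prod big_mkcond prod4E /= ?mul1r ?mulr1.
Qed.

(* A system orthogonal to [1] and to [z] is a multiple of the divided-difference weights
   [1 / nodal_prod z i] by an affine function of [z i]. *)
Lemma affine_interpolation (z : 'I_4 -> R) (y : 'I_4 -> 'rV[R]_3) : injective z ->
  \sum_i y i = 0 -> \sum_i z i *: y i = 0 ->
  exists A B, forall i, nodal_prod z i *: y i = A + z i *: B.
Proof.
move=> zI; rewrite !sum4E => s1 s2.
have zN i j : i != j -> z i - z j != 0.
  by rewrite subr_eq0 (inj_eq zI).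
have z01 := zN 0 1 isT; have z23 := zN 2 3 isT.
have [E0 E1 E2 E3] := nodal_prodE z.
(* The slope and intercept are read off at nodes 0 and 1; the two relations then determine [y 2] and
   [y 3]. *)
pose B := (z 0 - z 1)^-1 *: (nodal_prod z 0 *: y 0 - nodal_prod z 1 *: y 1).
exists (nodal_prod z 0 *: y 0 - z 0 *: B), B => i.
apply/rowP => k; have /rowP/(_ k) := s1; have /rowP/(_ k) := s2.
rewrite !mxE; case: (ord4P i) => ->; rewrite ?E0 ?E1 ?E2 ?E3.
- by move=> _ _; field.
- by move=> _ _; field.
- move: (y 0 0 k) (y 1 0 k) (y 2 0 k) (y 3 0 k) => y0 y1 y2 y3 e2 e1.
  have -> : y2 = - (y0 * (z 0 - z 3) + y1 * (z 1 - z 3)) / (z 2 - z 3).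
    by apply: (mulIf z23); rewrite divfK//; have := congr1 ( *%R (z 3)) e1; lra.
  by field; rewrite z01.
- move: (y 0 0 k) (y 1 0 k) (y 2 0 k) (y 3 0 k) => y0 y1 y2 y3 e2 e1.
  have -> : y3 = (y0 * (z 0 - z 2) + y1 * (z 1 - z 2)) / (z 2 - z 3).
    by apply: (mulIf z23); rewrite divfK//; have := congr1 ( *%R (z 2)) e1; lra.
  by field; rewrite z01.
Qed.

Definition parity_sign (b : bool) : R := if b then 1 else -1.

(** Of the three factors at node [i], exactly [3 - i] are negative. *)
Lemma parity_sign_nodal_prod (z : 'I_4 -> R) (i : 'I_4) :
  (forall i j : 'I_4, (i < j)%N -> z i < z j) -> 0 < parity_sign (odd i) * nodal_prod z i.
Proof.
move=> zlt; have [E0 E1 E2 E3] := nodal_prodE z.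
have z01 := zlt 0 1 isT; have z12 := zlt 1 2 isT; have z23 := zlt 2 3 isT.
have z02 := lt_trans z01 z12; have z13 := lt_trans z12 z23.
have z03 := lt_trans z01 z13.
case: (ord4P i) => ->; rewrite /parity_sign /= ?E0 ?E1 ?E2 ?E3 ?mul1r ?mulN1r ?oppr_gt0.
- by rewrite nmulr_llt0 ?subr_lt0// nmulr_rgt0 subr_lt0.
- by rewrite nmulr_lgt0 ?subr_lt0// nmulr_llt0 ?subr_lt0 // subr_gt0.
- by rewrite nmulr_llt0 ?subr_lt0// mulr_gt0 ?subr_gt0.
- by rewrite !mulr_gt0 ?subr_gt0.
Qed.

End Combinatorics.

(** * Dependencies of a pinned line *)

Section PinnedLines.
Variable R : realType.
Implicit Types (F G : set (set 'rV[R]_3)) (l : line R).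

Lemma dot_mulmx (u v : 'rV[R]_3) : (u *m v^T) 0 0 = dot u v.
Proof. by rewrite mxE; apply: eq_bigr => i _; rewrite mxE. Qed.

Lemma four_unit_ballsP F : four_unit_balls F -> exists c : 'I_4 -> 'rV[R]_3,
  F = range (fun i => eball (c i) 1) /\ injective (fun i => eball (c i) 1).
Proof.
move=> [/card_esym/card_set_bijP[X [XF Xinj Xsurj]] Fball].
have /choice[c cE] i : exists c, X i = eball c 1 by apply: Fball; exact: XF.
have XE : X = fun i => eball (c i) 1 by apply/funext.
exists c; rewrite -XE; split.
  apply/seteqP; split=> [Y /Xsurj[i _ <-]|_ [i _ <-]]; last exact: XF.
  by exists i.
by move=> i j; apply: Xinj; rewrite inE.
Qed.

(* Gordan's alternative applied to the first-order effect of a displacement [q + t w] of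
   the line on its distances to the balls tangent to it. *)
Lemma pinned_dependency F l p d : four_unit_balls F -> pins F l ->
  line_set l = affine_line (p, d) -> dot d d = 1 ->
  exists (c m : 'I_4 -> 'rV[R]_3) (z lam : 'I_4 -> R),
    [/\ F = range (fun i => eball (c i) 1), injective (fun i => eball (c i) 1) &
        injective z] /\
    [/\ forall i, 0 <= lam i,
        forall i, 0 < lam i ->
          [/\ c i = p + z i *: d + m i, dot (m i) (m i) = 1 & dot (m i) d = 0],
        exists i, 0 < lam i,
        \sum_i lam i *: m i = 0 & \sum_i z i *: (lam i *: m i) = 0].
Proof.
move=> /four_unit_ballsP[c [FE cI]] pl lE d1.
have d0 : d != 0 by rewrite -dot_gt0 d1.
pose h i := dot (c i - p) d; pose m i := c i - p - h i *: d.
have cE i : c i = p + h i *: d + m i.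
  by rewrite /m; apply: row3P; rewrite !mxE; ring.
have md i : dot (m i) d = 0.
  by rewrite dotDl dotNl dotZl d1 mulr1 subrr.
have distE i t : dot (p + t *: d - c i) (p + t *: d - c i) =
    (t - h i) ^+ 2 + dot (m i) (m i).
  rewrite (_ : _ - c i = (t - h i) *: d - m i); last first.
    by rewrite cE; apply: row3P; rewrite !mxE; ring.
  by move: (md i); move: (m i) => n nd; rewrite !dotE (dotC d) nd d1; ring.
have [tl _] := pl; move: tl => /set_mem[meet sep].
have m1 i : dot (m i) (m i) <= 1.
  have [|x []] := meet (eball (c i) 1); first by rewrite FE; exists i.
  rewrite lE => -[t _ /= <-] /eball1E; rewrite distE; have := sqr_ge0 (t - h i); lra.
pose T i := dot (m i) (m i) == 1.
have tang i : T i -> tangent_at l (eball (c i) 1) (p + h i *: d).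
  move=> /eqP Ti; apply/(tangent_atP _ _ lE d0); split.
  - by rewrite lE; exact: mem_affine_line.
  - by rewrite cE addrC addKr.
  - by rewrite cE addrC addKr.
(* Two balls tangent at the same height would touch the line at a common point, which the contact
   clause forbids. *)
have hI i j : T i -> T j -> h i = h j -> i = j.
  move=> Ti Tj hij; apply: cI; apply: contrapT => ne.
  apply: (sep _ _ (p + h i *: d) _ _ ne); [by rewrite FE; exists i| |].
    by rewrite FE; exists j.
  by split; [exact: tang | rewrite hij; exact: tang].
have nT i : ~~ T i -> dot (m i) (m i) < 1 by move=> nTi; rewrite lt_neqAle nTi m1.
pose s := [seq i <- enum 'I_4 | T i].
(* Gordan in dimension six: a solution is a pair [(q, w)] with [dot (m i) (q + h i *: w) > 0] for
   every tangent ball. *)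
have [[x xP]|[lam [lam0 [i0 i0s lami0] lamE]]] :=
    gordan (fun i => row_mx (m i) (h i *: m i)) (filter_uniq T (enum_uniq 'I_4) : uniq s).
  exfalso.
  (* The displacement must really move the line. Positivity at one tangent ball ensures this; with
     no tangent ball, a translation orthogonal to [d] serves. *)
  have [[q w] [/= qwP qwN]] : exists qw : 'rV[R]_3 * 'rV[R]_3,
      (forall i, T i -> 0 < dot (m i) (qw.1 + h i *: qw.2)) /\
      (forall e t k : R, 0 < e -> e *: qw.1 = t *: d -> d + e *: qw.2 = k *: d -> False).
    have [[i0 Ti0]|noT] := pselect (exists i, T i); last first.
      have [u u0 du] := ex_perp d; exists (u, 0); split=> [i Ti|e t k e0 /= eu _].
        by case: noT; exists i.
      have := congr1 (dot u) eu; rewrite !dotZr (dotC u d) du mulr0 => /eqP.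
      by rewrite mulf_eq0 dot_eq0 (negPf u0) gt_eqF.
    have qwP i : T i -> 0 < dot (m i) (lsubmx x + h i *: rsubmx x).
      move=> Ti; have := xP i; rewrite mem_filter Ti mem_enum => /(_ isT).
      rewrite -{1}(hsubmxK x) tr_row_mx mul_row_col mxE !dot_mulmx.
      by rewrite dotDr dotZl dotZr.
    exists (lsubmx x, rsubmx x); split=> // e t k e0 /= qE wE.
    have := qwP i0 Ti0; rewrite -(pmulr_rgt0 _ e0) -dotZr scalerDr qE.
    rewrite scalerA mulrC -scalerA (_ : e *: rsubmx x = (k - 1) *: d); last first.
      by rewrite scalerBl scale1r -wE addrC addKr.
    by rewrite dotDr !dotZr md !mulr0 addr0 ltxx.
  have [|e e0 lE'] := pins_deformation (q := q) (w := w) (eq_ind _ (pins ^~ l) pl _ FE) lE d1.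
    move=> i; have [Ti|/nT ?] := boolP (T i); last by left.
    by right; split; [exact/eqP | exact: qwP].
  have [t [k [qE wE]]] := affine_line_eq (etrans (esym lE') lE).
  by apply: (qwN e t k e0 _ wE); apply: (addrI p).
pose la i := if T i then lam i else 0.
have laE (f : 'I_4 -> 'rV[R]_3) : \sum_i la i *: f i = \sum_(i <- s) lam i *: f i.
  rewrite big_filter enumT [RHS]big_mkcond; apply: eq_bigr => i _.
  by rewrite /la; case: ifP; rewrite ?scale0r.
have laP i : 0 < la i -> T i by rewrite /la; case: ifP; rewrite ?ltxx.
have [sum1 sum2] : \sum_i la i *: m i = 0 /\ \sum_i la i *: (h i *: m i) = 0.
  have := lamE.
  rewrite (eq_bigr (fun i => row_mx (lam i *: m i) (lam i *: (h i *: m i)))); last first.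
    by move=> i _; rewrite scale_row_mx.
  move=> e; rewrite !laE; split.
    have := congr1 lsubmx e; rewrite !linear_sum /= linear0 => e0; rewrite -[RHS]e0.
    by apply: eq_bigr => i _; rewrite row_mxKl.
  have := congr1 rsubmx e; rewrite !linear_sum /= linear0 => e0; rewrite -[RHS]e0.
  by apply: eq_bigr => i _; rewrite row_mxKr.
(* Balls of weight zero may receive any height; [M + i] exceeds all true heights, which makes [z]
   injective. *)
pose M := 1 + \sum_i `|h i|.
have hM i j : h i != M + (j : nat)%:R.
  rewrite lt_eqF //; apply: (@lt_le_trans _ _ M); last by rewrite lerDl ler0n.
  apply: (@le_lt_trans _ _ (\sum_i `|h i|)); last by rewrite ltrDr.
  rewrite (bigD1 i) //=; apply: (le_trans (ler_norm _)).
  by rewrite lerDl sumr_ge0.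
pose z (i : 'I_4) := if T i then h i else M + (i : nat)%:R.
exists c, m, z, la; split; split=> //.
- move=> i j; rewrite /z; case: ifPn => Ti; case: ifPn => Tj.
  + exact: hI.
  + by move=> /eqP; rewrite (negPf (hM _ _)).
  + by move=> /esym/eqP; rewrite (negPf (hM _ _)).
  + by move=> /addrI/eqP; rewrite eqr_nat => /eqP/val_inj.
- by move=> i; rewrite /la; case: ifP.
- by move=> i /laP Ti; split; [rewrite /z Ti; exact: cE|exact/eqP|exact: md].
- by exists i0; rewrite /la; move: i0s; rewrite mem_filter => /andP[->].
- rewrite -[RHS]sum2; apply: eq_bigr => i _; rewrite /z /la.
  by case: ifP => _; rewrite ?scale0r ?scaler0// !scalerA mulrC.
Qed.

Lemma sorted_pinned_dependency F l p d : four_unit_balls F -> pins F l ->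
  line_set l = affine_line (p, d) -> dot d d = 1 ->
  exists (c m : 'I_4 -> 'rV[R]_3) (z lam : 'I_4 -> R),
    [/\ F = range (fun i => eball (c i) 1), injective (fun i => eball (c i) 1) &
        forall i j : 'I_4, (i < j)%N -> z i < z j] /\
    [/\ forall i, 0 <= lam i,
        forall i, 0 < lam i ->
          [/\ c i = p + z i *: d + m i, dot (m i) (m i) = 1 & dot (m i) d = 0],
        exists i, 0 < lam i,
        \sum_i lam i *: m i = 0 & \sum_i z i *: (lam i *: m i) = 0].
Proof.
move=> F4 pl lE d1.
have [c [m [z [lam [[FE cI zI] [lam0 lamP [i0 lami0] s1 s2]]]]]] :=
  pinned_dependency F4 pl lE d1.
have [s sI sz] := increasing_reindexing zI; have [s' ss' s's] := injF_bij sI.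
exists (c \o s), (m \o s), (z \o s), (lam \o s); split; split=> //=.
- rewrite FE; apply/seteqP; split=> _ [i _ <-]; last by exists (s i).
  by exists (s' i) => //=; rewrite s's.
- by move=> i j /cI/sI.
- by move=> i /lamP.
- by exists (s' i0); rewrite s's.
- by rewrite -[RHS]s1 [RHS](reindex_inj sI).
- by rewrite -[RHS]s2 [RHS](reindex_inj sI).
Qed.

End PinnedLines.

(** * Parallel offsets and proper pinning subfamilies *)

Section MinimalPinning.
Variable R : realType.
Implicit Types (F G : set (set 'rV[R]_3)) (l : line R).

(** Pairing with [u] gives scalars orthogonal to constants and to [z], hence two sign changes. The
    three balls found lie alternately on opposite sides in one plane through the line and pin it. *)
Lemma coplanar_dependency F l p d u (c m : 'I_4 -> 'rV[R]_3) (z lam : 'I_4 -> R) :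
  line_set l = affine_line (p, d) -> dot d d = 1 -> line_transversal F l ->
  F = range (fun i => eball (c i) 1) -> injective (fun i => eball (c i) 1) ->
  injective z -> (forall i, 0 <= lam i) ->
  (forall i, 0 < lam i ->
     [/\ c i = p + z i *: d + m i, dot (m i) (m i) = 1 & dot (m i) d = 0]) ->
  (exists i, 0 < lam i) ->
  \sum_i lam i *: m i = 0 -> \sum_i z i *: (lam i *: m i) = 0 ->
  (forall i, 0 < lam i -> m i = dot (m i) u *: u) ->
  exists2 G, G `<` F & pins G l.
Proof.
move=> lE d1 tl FE cI zI lam0 lamP [i0 lami0] s1 s2 mu.
pose a i := lam i * dot (m i) u.
have dotu_sum (f : 'I_4 -> 'rV[R]_3) : dot (\sum_i f i) u = \sum_i dot (f i) u.
  by rewrite !sum4E !dotDl.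
have sa : \sum_i a i = 0.
  rewrite -[RHS](dot0l u) -s1 dotu_sum; apply: eq_bigr => i _.
  by rewrite dotZl.
have saz : \sum_i a i * z i = 0.
  rewrite -[RHS](dot0l u) -s2 dotu_sum; apply: eq_bigr => i _.
  by rewrite !dotZl mulrC.
have a0 : exists i, a i != 0.
  exists i0; rewrite mulf_neq0 //; first by rewrite gt_eqF.
  apply/eqP => e.
  have [_ + _] := lamP _ lami0; rewrite (mu _ lami0) e scale0r dot0l.
  by move=> /eqP; rewrite eq_sym oner_eq0.
have [i [j [k [zij zjk aij ajk]]]] := alternating_signs zI sa saz a0.
have pos h : a h != 0 -> 0 < lam h.
  by rewrite lt0r lam0 andbT; apply: contraNneq; rewrite /a => ->; rewrite mul0r.
have nz x y : x * y < 0 :> R -> (x != 0) && (y != 0).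
  by move=> xy; rewrite -negb_or -mulf_eq0 lt_eqF.
have /andP[/pos li /pos lj] := nz _ _ aij; have /andP[_ /pos lk] := nz _ _ ajk.
have [ci mi1 mid] := lamP _ li; have [cj mj1 mjd] := lamP _ lj.
have [ck mk1 mkd] := lamP _ lk.
(* Two multiples of [u] of equal norm and opposite sign are opposite vectors. *)
have opp f g : 0 < lam f -> 0 < lam g -> a f * a g < 0 ->
    dot (m f) (m f) = 1 -> dot (m g) (m g) = 1 -> m g = - m f.
  move=> lf lg afg; rewrite (mu _ lf) (mu _ lg); move: afg; rewrite /a.
  set x := dot (m f) u; set y := dot (m g) u => afg.
  rewrite !dotZl !dotZr => xu yu.
  have xy : x * y < 0.
    have ll : 0 < lam f * lam g by rewrite mulr_gt0.
    by rewrite -(pmulr_rlt0 _ ll); move: afg; rewrite mulrACA.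
  have u0 : 0 < dot u u.
    by rewrite lt0r dot_ge0 andbT; apply/eqP => u0; move: xu; rewrite u0 !mulr0; lra.
  have : (x + y) * (x - y) = 0.
    by apply: (mulIf (lt0r_neq0 u0)); rewrite mul0r; lra.
  move=> /eqP; rewrite mulf_eq0 subr_eq0 => /orP[|/eqP xy0]; last first.
    by move: xy; rewrite xy0 -expr2 ltNge sqr_ge0.
  by rewrite addrC addr_eq0 => /eqP ->; rewrite scaleNr.
have mj := opp _ _ li lj aij mi1 mj1.
have mk : m k = m i by rewrite (opp _ _ lj lk ajk mj1 mk1) mj opprK.
pose G := [set Y | exists2 h, h \in [:: i; j; k] & Y = eball (c h) 1].
have GF : G `<=` F by move=> _ [h _ ->]; rewrite FE; exists h.
exists G; last first.
  apply: (@pins_alternating_triple R l p d (m i) G (z i) (z j) (z k)) => //.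
  - by exists i; rewrite ?mem_head// ci.
  - by exists j; rewrite ?inE ?eqxx ?orbT// cj mj.
  - by exists k; rewrite ?inE ?eqxx ?orbT// ck mk.
  - by split=> [Y /GF|Y Y' q /GF FY /GF FY']; [exact: tl.1 | exact: tl.2].
split=> // FG.
(* Three indices cannot account for four distinct balls. *)
have : (#|'I_4| <= #|[:: i; j; k]|)%N.
  apply: subset_leq_card; apply/fintype.subsetP => h _.
  have [|h' h's /cI ->//] := FG (eball (c h) 1).
  by rewrite FE; exists h.
by move=> /leq_trans/(_ (card_size _)); rewrite card_ord.
Qed.

(** For nonzero [B], the vector [A] is orthogonal to [d] and [cross d B], hence parallel to
    [cross d (cross d B) = - B]. *)
Lemma parallel_of_degenerate (d A B : 'rV[R]_3) : dot d d = 1 -> dot A d = 0 ->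
  dot B d = 0 -> dot A (cross d B) = 0 ->
  exists2 u, dot u u = 1 & forall s, A + s *: B = dot (A + s *: B) u *: u.
Proof.
move=> d1 Ad Bd AB.
have unit_parallel v w : v != 0 -> w = (dot w v / dot v v) *: v ->
    w = dot w ((enorm v)^-1 *: v) *: ((enorm v)^-1 *: v).
  move=> v0 {1}->; rewrite dotZr scalerA -enorm_sqr expr2 invfM.
  by congr (_ *: _); ring.
have unit1 v : v != 0 -> dot ((enorm v)^-1 *: v) ((enorm v)^-1 *: v) = 1.
  move=> v0; have n0 : enorm v != 0 by rewrite sqrtr_eq0 -ltNge dot_gt0.
  by rewrite dotZl dotZr -enorm_sqr; field.
have [B0|B0] := eqVneq B 0.
  have [A0|A0] := eqVneq A 0.
    by exists d => // s; rewrite A0 B0 scaler0 addr0 dot0l scale0r.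
  exists ((enorm A)^-1 *: A); first exact: unit1.
  move=> s; rewrite B0 scaler0 addr0; apply: unit_parallel => //.
  by rewrite divff ?scale1r// dot_eq0.
exists ((enorm B)^-1 *: B); first exact: unit1.
move=> s; apply: unit_parallel => //.
have AE : dot B B *: A = dot A B *: B.
  have dB : cross d (cross d B) = - B.
    have -> : cross d (cross d B) = dot B d *: d - dot d d *: B.
      by apply: row3P; rewrite !dot3E !mxE /=; ring.
    by rewrite Bd d1 scale0r scale1r sub0r.
  by have := perp_cross Ad AB; rewrite dB !dotNl !dotNr opprK scalerN scaleNr opprK.
have BB : dot B B != 0 by rewrite dot_eq0.
rewrite dotDl dotZl mulrDl scalerDl mulfK//; congr (_ + _).
by rewrite mulrC -scalerA -AE scalerA mulVf// scale1r.
Qed.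

End MinimalPinning.

(** * The configuration *)

Section Configuration.
Variable R : realType.
Variables (F : set (set 'rV[R]_3)) (l : line R) (p d A B : 'rV[R]_3).
Variables (c m : 'I_4 -> 'rV[R]_3) (z k : 'I_4 -> R).
Hypotheses (lE : line_set l = affine_line (p, d)) (d1 : dot d d = 1).
Hypotheses (Ad : dot A d = 0) (Bd : dot B d = 0) (AB : dot A (cross d B) != 0).
Hypothesis FE : F = range (fun i => eball (c i) 1).
Hypothesis zlt : forall i j : 'I_4, (i < j)%N -> z i < z j.
Hypothesis cE : forall i, c i = p + z i *: d + m i.
Hypothesis m1 : forall i, dot (m i) (m i) = 1.
Hypothesis mE : forall i, m i = k i *: parab_normal A B (z i).
Hypothesis k_sign : forall i : 'I_4, 0 < parity_sign R (odd i) * k i.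

Let H := paraboloid p d A B.

Let d0 : d != 0. Proof. by rewrite -dot_gt0 d1. Qed.

Let k0 i : k i != 0.
Proof. by apply: contraTneq (k_sign i) => ->; rewrite mulr0 ltxx. Qed.

Let md i : dot (m i) d = 0.
Proof. by rewrite mE dotZl (parab_normal_perp Ad Bd) mulr0. Qed.

Let cp i : c i - (p + z i *: d) = m i.
Proof. by rewrite cE addrC addKr. Qed.

Let z_inj : injective z.
Proof. exact: increasing_injective zlt. Qed.

Lemma tangent_axis i : tangent_at l (eball (c i) 1) (p + z i *: d).
Proof.
apply/(tangent_atP _ _ lE d0); split; rewrite ?cp//.
by rewrite lE; exact: mem_affine_line.
Qed.

Lemma tangent_axis_unique i q : tangent_at l (eball (c i) 1) q -> q = p + z i *: d.
Proof.
rewrite /tangent_at (tangent_axis i) => e; have : [set q] q by [].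
by rewrite -e.
Qed.

(** A ridge is orthogonal to [d] and to [m i], a nonzero multiple of [parab_normal]; [perp_cross]
    then leaves only the direction of the ruling. *)
Lemma ridge_in_rulings : ridges F l `<=` parab_rulings p d A B.
Proof.
move=> r [X]; rewrite FE => -[i _ <-] [q [/tangent_axis_unique -> tr perp]].
exists (z i); set q0 := p + z i *: d in tr *.
have [x [v [v1 rE]]] := line_unit_direction r.
have v0 : v != 0 by rewrite -dot_gt0 v1.
have [rq _] := (tangent_atP _ _ rE v0).1 tr; rewrite cp => mv.
have vd : dot v d = 0.
  have := perp x (x + v) p (p + d); rewrite (addrC x) addrK (addrC p) addrK.
  apply; rewrite ?rE ?lE.
  - by exists 0; rewrite //= scale0r addr0.
  - by exists 1; rewrite //= scale1r addrC.
  - by exists 0; rewrite //= scale0r addr0.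
  - by exists 1; rewrite //= scale1r addrC.
have vN : dot v (parab_normal A B (z i)) = 0.
  apply: (mulfI (k0 i)); rewrite -dotZr -mE mulr0 dotC; exact: mv.
have cc := ruling_direction d1 Ad Bd AB (z i).
have := perp_cross vd vN; set w := cross _ _ in cc *; move=> e.
have [t _ /= qE] : affine_line (x, v) q0 by rewrite -rE.
rewrite rE -[in RHS](@affine_line_reparam R q0 w 0 (dot v w / dot w w)).
  rewrite scale0r addr0 (mulrC (dot v w)) -scalerA -e scalerA mulVf ?gt_eqF// scale1r -qE.
  by have := affine_line_reparam x v t (oner_neq0 R); rewrite scale1r => ->.
rewrite mulf_neq0 //; last by rewrite invr_neq0 ?gt_eqF.
apply/eqP => vw.
move: e; rewrite vw scale0r => /eqP; rewrite scaler_eq0 (negPf v0) orbF.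
by rewrite gt_eqF.
Qed.

(** The rulings at the four contact heights are ridges, and distinct heights make them distinct. *)
Lemma four_ridges : ([set: 'I_4] #<= ridges F l)%card.
Proof.
have /choice[r rE] (i : 'I_4) : exists r : line R,
    line_set r = affine_line (p + z i *: d, cross d (parab_normal A B (z i))).
  by apply: mk_line; rewrite -dot_gt0; exact: ruling_direction.
have rI : injective r.
  move=> i j rij; apply: z_inj.
  have : line_set (r i) (p + z i *: d) by rewrite rE; exists 0; rewrite //= scale0r addr0.
  rewrite rij rE => -[t _ /= /(congr1 (dot^~ d))].
  by rewrite !dotDl !dotZl dot_crossl d1 mulr0 addr0 !mulr1 => /addrI.
have rr : range r `<=` ridges F l.
  move=> _ [i _ <-]; exists (eball (c i) 1); first by rewrite FE; exists i.
  have w0 : cross d (parab_normal A B (z i)) != 0.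
    by rewrite -dot_gt0; exact: ruling_direction.
  exists (p + z i *: d); split; first exact: tangent_axis.
    apply/(tangent_atP _ _ (rE i) w0); split; rewrite ?cp//.
      by rewrite rE; exists 0; rewrite //= scale0r addr0.
    by rewrite mE dotZl dotC dot_crossr mulr0.
  move=> x y u v; rewrite rE lE => -[t1 _ /= <-] [t2 _ /= <-] [t3 _ /= <-] [t4 _ /= <-].
  rewrite (_ : _ - _ = (t2 - t1) *: cross d (parab_normal A B (z i))); last first.
    by apply: row3P; rewrite !mxE; ring.
  rewrite (_ : _ - _ = (t4 - t3) *: d); last first.
    by apply: row3P; rewrite !mxE; ring.
  by rewrite dotZl dotZr dot_crossl !mulr0.
apply: card_le_trans (subset_card_le rr).
by rewrite (card_le_eqr (inj_card_eq _)) ?card_lexx// => i j _ _ /rI.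
Qed.

(** The sides are the two sign regions of [parab_fun], and [m i] serves as the normal; [k_sign]
    places it in the region given by the parity of [i]. *)
Lemma alternating_configuration : four_unit_balls F -> alternating_hyperboloidal F l.
Proof.
move=> F4; split=> //.
  by move=> X; rewrite FE => -[i _ <-]; exists (p + z i *: d); exact: tangent_axis.
exists H; split; first exact: hyperbolic_paraboloidP.
  split; first exact: four_ridges.
  exists (parab_rulings p d A B); first exact: ruling_family_paraboloid.
  exact: ridge_in_rulings.
pose S b := [set x | 0 < parity_sign R b * parab_fun p d A B x].
have sideS b : side H (S b).
  apply: side_paraboloid => //; rewrite /parity_sign.
  by case: b; rewrite ?mulr1// mulrNN mulr1.
exists (fun i => eball (c i) 1), (fun i => p + z i *: d), m, d, S; split.
  split=> // [i|i j ij]; first exact: tangent_axis.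
  exists (z j - z i); first by rewrite subr_gt0 zlt.
  by rewrite -addrA -scalerDl (addrC (z i)) subrK.
split=> // [Seq|i].
  have [x xH ST] := sideS true; have xS : S true x.
    by rewrite ST; exact: connected_component_refl.
  have : S false x by rewrite -Seq.
  by move: xS; rewrite /S /= mul1r mulN1r; lra.
split.
- rewrite mE; exact: normal_at_paraboloid.
- by exists (c i), 1; rewrite scale1r cp.
- rewrite mE; exact: points_to_side_paraboloid.
Qed.

End Configuration.

Theorem theorem14 (R : realType) (F : set (set 'rV[R]_3)) (l : line R) :
  four_unit_balls F -> non_overlapping F -> minimally_pins F l ->
  alternating_hyperboloidal F l.
Proof.
move=> F4 _ [pl minF]; have [p [d [d1 lE]]] := line_unit_direction l.
have [c [m [z [lam [[FE cI zlt] [lam0 lamP lam_pos s1 s2]]]]]] :=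
  sorted_pinned_dependency F4 pl lE d1.
have zI := increasing_injective zlt.
have [A [B ABE]] := affine_interpolation zI s1 s2.
have D0 i : nodal_prod z i != 0.
  by apply: contraTneq (parity_sign_nodal_prod i zlt) => ->; rewrite mulr0 ltxx.
have perp i : dot (A + z i *: B) d = 0.
  rewrite -ABE !dotZl; have [->|li] := eqVneq (lam i) 0; first by rewrite mul0r mulr0.
  have lp : 0 < lam i by rewrite lt0r li lam0.
  by have [_ _ ->] := lamP i lp; rewrite !mulr0.
(* An affine function of the height that vanishes at two distinct heights is zero. *)
have Bd : dot B d = 0.
  have := perp 0; have := perp 1; rewrite !dotDl !dotZl => e1 e0.
  have z01 : z 0 - z 1 != 0 by rewrite subr_eq0 lt_eqF// zlt.
  by apply: (mulfI z01); lra.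
have Ad : dot A d = 0 by have := perp 0; rewrite dotDl dotZl Bd mulr0 addr0.
have mlE i : 0 < lam i -> m i = (nodal_prod z i * lam i)^-1 *: (A + z i *: B).
  move=> li; rewrite -ABE [nodal_prod z i *: _]scalerA scalerA.
  by rewrite mulVf ?scale1r// mulf_neq0 ?D0 ?gt_eqF.
(* If [A] and [B] are dependent, all offsets of positive weight are parallel and a proper subfamily
   already pins the line. *)
have [det0|det0] := eqVneq (dot A (cross d B)) 0.
  have [u u1 uE] := parallel_of_degenerate d1 Ad Bd det0.
  have [G GF /(minF _ GF)//] : exists2 G, G `<` F & pins G l.
  apply: (coplanar_dependency (u := u) lE d1 _ FE cI zI lam0 lamP lam_pos s1 s2).
    by have [/set_mem] := pl.
  move=> i /mlE ->; rewrite {1}uE dotZl scalerA.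
  by [].
(* A zero weight would make [A + z i *: B] vanish, against independence. *)
have lam_gt0 i : 0 < lam i.
  rewrite lt0r lam0 andbT; apply/eqP => li.
  have := parab_normal_neq0 det0 (z i).
  by rewrite /parab_normal -ABE li scale0r scaler0 eqxx.
apply: (alternating_configuration (c := c) (m := m) (z := z) lE d1 Ad Bd det0 FE zlt
  (k := fun i => (nodal_prod z i * lam i)^-1)) => // i.
- by have [] := lamP i (lam_gt0 i).
- by have [] := lamP i (lam_gt0 i).
- exact: mlE.
- have li := gt_eqF (lam_gt0 i); have Di := negPf (D0 i).
  (* The inverse of [nodal_prod z i * lam i] is this product times the square of the inverse, so it
     has the sign of [nodal_prod z i]. *)
  rewrite (_ : _ * _ = parity_sign R (odd i) * nodal_prod z i *
      (lam i * (nodal_prod z i * lam i)^-1 ^+ 2)); last by field; rewrite li Di.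
  rewrite mulr_gt0 ?parity_sign_nodal_prod// mulr_gt0//.
  by rewrite lt0r sqr_ge0 sqrf_eq0 invr_eq0 mulf_eq0 li Di.
Qed.
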